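(* Let $P\subseteq\mathbb{R}^d$ be a full-dimensional polyhedron not containing lines and let $P'=g\cdot P$, where $g\in\mathrm{PGL}(d+1)$ is a projective transformation. Let $\mathbf z'=(z_1',\ldots,z_d')$ be the image of the coordinates $z_1,\ldots,z_d$ under $g$. Then $$\mathrm{Vol}^\vee_{\mathbf z}(P)=\det\left(\frac{\partial z_j'}{\partial z_i}\right)\mathrm{Vol}^\vee_{\mathbf z'}(P').$$
   Context: $\mathbb{R}^d$ is regarded as an affine chart of $\mathbb{P}^d(\mathbb{R})=\mathbb{R}^d\sqcup H_\infty$, on which $\mathrm{PGL}(d+1)$ acts; in the chart, $g$ acts by a fractional-linear map $\mathbf z\mapsto\mathbf z'$. Here $P'$ is again a polyhedron in $\mathbb{R}^d$, and $P'=g\cdot P$ means that the closures $\bar P,\bar P'\subset\mathbb{P}^d(\mathbb{R})$ are related by $g$. Orientations of polytopes are ignored. A polyhedron is a non-empty finite intersection of closed half-spaces. Its support function is $h_P(\mathbf v)=-\min_{\mathbf y\in P}\langle\mathbf v,\mathbf y\rangle\in\mathbb{R}\cup\{\infty\}$; the normal fan $\mathcal N(P)$ consists of the cones $C_F=\{\mathbf v:h_P(\mathbf v)=-\langle\mathbf v,\mathbf y\rangle\ne\infty\ \forall\mathbf y\in F\}$, $F$ a face of $P$. The dual volume function is the rational function of $\mathbf z=(z_1,\dots,z_d)$ $$\mathrm{Vol}^\vee_{\mathbf z}(P)=\sum_{C=\mathrm{span}_{\ge0}(\mathbf v_{1},\dots,\mathbf v_{d})\in\mathcal T}\frac{|\det(\mathbf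 v_{1},\dots,\mathbf v_{d})|}{\prod_{j=1}^d\bigl(h_P(\mathbf v_{j})+\langle\mathbf v_{j},\mathbf z\rangle\bigr)},$$ where $\mathcal T$ is any triangulation of $\mathcal N(P)$ into full-dimensional simplicial cones generated by rays of $\mathcal N(P)$ (independent of $\mathcal T$ and of the scaling of generators).
   Formalization: The identity is proved up to a sign e = ±1 depending only on P and g, chosen so that e times the Jacobian determinant is positive on the interior of P; the displayed formula without it fails for orientation-reversing g (d=1, P=[0,1], z'=-z). *)

(* Defs.v *)
From HB Require Import structures.
From mathcomp Require Import all_boot all_order all_algebra.
From mathcomp Require Import generic_quotient.
From mathcomp Require Import all_classical all_reals all_analysis.
Set Implicit Arguments.
Unset Strict Implicit.
Unset Printing Implicit Defensive.
Import Order.TTheory GRing.Theory Num.Theory.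
Import numFieldNormedType.Exports.
Local Open Scope classical_set_scope.
Local Open Scope ring_scope.
Local Open Scope quotient_scope.

Section Polyhedra.
Context {R : realType} {d : nat}.
Implicit Types (P F C : set 'rV[R]_d) (v y z : 'rV[R]_d).

Definition dotv v y : R := \sum_(i < d) v 0 i * y 0 i.

Definition halfspace (a : 'rV[R]_d) (b : R) : set 'rV[R]_d :=
  [set y | b <= dotv a y].

Definition polyhedron P : Prop :=
  P !=set0 /\
  exists s : seq ('rV[R]_d * R),
    (forall h, h \in s -> h.1 != 0) /\
    P = [set y | forall h, h \in s -> halfspace h.1 h.2 y].

(* The affine hull of P is R^d: P has d + 1 affinely independent points. *)
Definition full_dimensional P : Prop :=
  exists (p0 : 'rV[R]_d) (p : 'I_d -> 'rV[R]_d),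
    [/\ P p0, (forall i, P (p i)) & \matrix_i (p i - p0) \in unitmx].

Definition contains_line P : Prop :=
  exists x v, v != 0 /\ forall t : R, P (x + t *: v).

(* On a polyhedron, the infimum is a minimum as soon as it is not -oo. *)
Definition support_fun P v : \bar R :=
  (- ereal_inf [set (dotv v y)%:E | y in P])%E.

(* Only nonempty faces; v = 0 gives P itself. *)
Definition poly_face P F : Prop :=
  F !=set0 /\
  exists v, F = [set y | P y /\ forall x, P x -> dotv v y <= dotv v x].

Definition normal_cone P F : set 'rV[R]_d :=
  [set v | support_fun P v <> +oo%E /\
           forall y, F y -> support_fun P v = (- dotv v y)%:E].

Definition normal_fan P : set (set 'rV[R]_d) :=
  [set C | exists2 F, poly_face P F & C = normal_cone P F].

Definition ray v : set 'rV[R]_d := [set t *: v | t in [set t : R | 0 <= t]].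

Definition spans_ray_of_fan (N : set (set 'rV[R]_d)) v : Prop :=
  v != 0 /\ N (ray v).

(* The cone generated by the rows of A whose index lies in S; when A is
   invertible, these are the faces of the simplicial cone of all rows. *)
Definition row_cone (A : 'M[R]_d) (S : {set 'I_d}) : set 'rV[R]_d :=
  [set v | exists c : 'I_d -> R,
     (forall j, 0 <= c j) /\ v = \sum_(j in S) c j *: row j A].

Definition simplicial_cone (A : 'M[R]_d) : set 'rV[R]_d := row_cone A [set: 'I_d]%SET.

(* A family of n simplicial cones, each given by the matrix whose rows are its
   generators: distinct indices give distinct cones. *)
Definition fan_triangulation (N : set (set 'rV[R]_d))
    (n : nat) (T : 'I_n -> 'M[R]_d) : Prop :=
  [/\ (forall i, T i \in unitmx),
      (forall i j, spans_ray_of_fan N (row j (T i))),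
      (forall i, exists2 C, N C & simplicial_cone (T i) `<=` C),
      \bigcup_(i in [set: 'I_n]) simplicial_cone (T i) = \bigcup_(C in N) C
    & (forall i k, i != k ->
         simplicial_cone (T i) <> simplicial_cone (T k) /\
         exists S S' : {set 'I_d},
           simplicial_cone (T i) `&` simplicial_cone (T k) = row_cone (T i) S
           /\ row_cone (T i) S = row_cone (T k) S')].

(* The linear factor of the denominator attached to the generator v. *)
Definition dual_factor P v z : R := fine (support_fun P v) + dotv v z.

Definition dual_volume P (n : nat) (T : 'I_n -> 'M[R]_d) z : R :=
  \sum_(i < n)
    `|\det (T i)| / \prod_(j < d) dual_factor P (row j (T i)) z.

(* z is not a pole of any summand of dual_volume. *)
Definition dual_volume_defined P (n : nat) (T : 'I_n -> 'M[R]_d) z : Prop :=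
  forall i j, dual_factor P (row j (T i)) z != 0.

End Polyhedra.

Section ProjectiveSpace.
Context (R : realType) (d : nat).

Definition homvec := set_type [set v : 'rV[R]_(1 + d) | v != 0].

(* Equality of row spaces, i.e. proportionality. *)
Definition proportional : rel homvec :=
  fun u v => (set_val u == set_val v)%MS.

Lemma proportional_equiv : equiv_class_of proportional.
Proof.
split=> [u|u v|v u w]; rewrite /proportional.
- exact/eqmxP.
- by rewrite andbC.
- by move=> /eqmxP uv /eqmxP vw; apply/eqmxP; exact: (eqmx_trans uv vw).
Qed.

Canonical proportional_equivRel := EquivRelPack proportional_equiv.

Definition projspace := quotient_topology {eq_quot proportional_equivRel}.

End ProjectiveSpace.

Section ProjectiveMaps.
Context {R : realType} {d : nat}.

Definition hompt (v : 'rV[R]_(1 + d)) (v0 : v != 0) : projspace R d :=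
  \pi_(projspace R d)
    (@exist _ (fun u => u \in [set u : 'rV[R]_(1 + d) | u != 0]) v (mem_set v0)
      : homvec R d).

Lemma row_mx1_neq0 (z : 'rV[R]_d) : row_mx (1%:M : 'rV[R]_1) z != 0.
Proof.
apply/eqP => /(congr1 (fun w : 'rV[R]_(1 + d) => lsubmx w 0 0)).
by rewrite row_mxKl !mxE eqxx => /eqP; rewrite oner_eq0.
Qed.

(* The point [1 : z]; the hyperplane at infinity is [0 : z]. *)
Definition chart (z : 'rV[R]_d) : projspace R d := hompt (row_mx1_neq0 z).

Lemma mulmx_unit_neq0 (G : 'M[R]_(1 + d)) (hG : G \in unitmx)
  (v : 'rV[R]_(1 + d)) : v != 0 -> v *m G != 0.
Proof. by apply: contraNneq => vG0; rewrite -(mulmxK hG v) vG0 mul0mx. Qed.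

(* Points are row vectors, so the element of PGL represented by G acts by right
   multiplication. *)
Definition homact (G : 'M[R]_(1 + d)) (hG : G \in unitmx) (u : homvec R d) :
    projspace R d :=
  hompt (mulmx_unit_neq0 hG (set_mem (valP u))).

Definition projact (G : 'M[R]_(1 + d)) (hG : G \in unitmx)
    (p : projspace R d) : projspace R d :=
  homact hG (repr p).

Definition projclosure (P : set 'rV[R]_d) : set (projspace R d) :=
  closure (chart @` P).

Definition homimage (G : 'M[R]_(1 + d)) (z : 'rV[R]_d) : 'rV[R]_(1 + d) :=
  row_mx 1%:M z *m G.

(* Vanishes exactly when the image of z lies on the hyperplane at infinity. *)
Definition chart_denom (G : 'M[R]_(1 + d)) (z : 'rV[R]_d) : R :=
  lsubmx (homimage G z) 0 0.

Definition chart_map (G : 'M[R]_(1 + d)) (z : 'rV[R]_d) : 'rV[R]_d :=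
  (chart_denom G z)^-1 *: rsubmx (homimage G z).

Lemma hompt_eq (v w : 'rV[R]_(1 + d)) (v0 : v != 0) (w0 : w != 0) :
  (v == w)%MS -> hompt v0 = hompt w0.
Proof. by move=> vw; exact/eqmodP. Qed.

Lemma projact_hompt (G : 'M[R]_(1 + d)) (hG : G \in unitmx)
    (v : 'rV[R]_(1 + d)) (v0 : v != 0) :
  projact hG (hompt v0) = hompt (mulmx_unit_neq0 hG v0).
Proof.
apply: hompt_eq; apply/eqmxP; apply: eqmxMr; apply/eqmxP.
by have /eqmodP := reprK (hompt v0).
Qed.

Lemma projact_chart (G : 'M[R]_(1 + d)) (hG : G \in unitmx) (z : 'rV[R]_d) :
  chart_denom G z != 0 -> projact hG (chart z) = chart (chart_map G z).
Proof.
move=> z0; rewrite projact_hompt; apply: hompt_eq; apply/eqmxP.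
have -> : row_mx 1%:M (chart_map G z) =
    (chart_denom G z)^-1 *: homimage G z.
  rewrite -[homimage G z in RHS]hsubmxK scale_row_mx; congr row_mx.
  apply/rowP => i; rewrite !ord1 -/(chart_denom G z) mxE eqxx.
  by rewrite [in RHS]mxE mulVf.
by apply/eqmx_sym/eqmx_scale; rewrite invr_eq0.
Qed.

End ProjectiveMaps.

(* Main.v *)
(** The dual volume is the Laplace transform of the dual cone
    [{w | w . (1, y) >= 0 for all y in P}] of the cone over [P], evaluated at
    [(1, z)]: each cone of a triangulation of the normal fan lifts to the
    simplicial cone spanned by [(1, 0)] and the vectors [(h_P(v_j), v_j)], these
    tile the dual cone, and a simplicial cone with generator matrix [W]
    contributes [|det W| / prod_j <w_j, x>]. The projective map acts linearly on
    dual cones, up to a sign, and its Jacobian determinant is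
    [det G / (denominator)^(d+1)], so everything reduces to the fact that two
    tilings of the same cone give the same sum.

    This additivity is proved without integration, by induction on the dimension.
    For a generic vector [u] with coordinates [a_j] in the basis [w_j], the
    identity [<u, x> = sum_j a_j <w_j, x>] writes the contribution of a cone as a
    signed sum over its facets. Grouping the facets by the hyperplane they span,
    the jump of the indicator identity across a hyperplane, in the direction
    [u], is the indicator identity required by the induction hypothesis. *)

From HB Require Import structures.
Require Import Defs.
From mathcomp Require Import all_boot all_order all_algebra.
From mathcomp Require Import generic_quotient ring lra.
From mathcomp Require Import all_classical all_reals all_analysis.
Import Order.TTheory GRing.Theory Num.Theory.
Import numFieldNormedType.Exports.
Local Open Scope classical_set_scope.
Local Open Scope ring_scope.

(** * Additivity of the contribution of simplicial cones *)

Section Valuation.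
Context {R : realFieldType}.

(** Adding or subtracting [t * ab.2] then preserves the sign of every nonzero [ab.1] in the list. *)
Lemma small_multiplier (s : seq (R * R)) :
  exists2 t, 0 < t & {in s, forall ab, ab.1 != 0 -> `|t * ab.2| < `|ab.1|}.
Proof.
elim: s => [|[a b] s [t t0 IH]]; first by exists 1.
pose t1 := if a == 0 then t else Num.min t (`|a| / (`|b| + 1)).
have b1 : 0 < `|b| + 1 by rewrite ltr_wpDl.
have t1_gt0 : 0 < t1.
  by rewrite /t1; case: eqVneq => // a0; rewrite lt_min t0 divr_gt0 ?normr_gt0.
have t1t : t1 <= t by rewrite /t1; case: eqVneq => // _; rewrite ge_min lexx.
exists t1 => // ab; rewrite inE => /predU1P[-> /= a0|abs ab0].
  rewrite normrM gtr0_norm //.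
  have t1a : t1 <= `|a| / (`|b| + 1) by rewrite /t1 (negPf a0) ge_min lexx orbT.
  apply: (@lt_le_trans _ _ (t1 * (`|b| + 1))).
    by rewrite ltr_pM2l // ltrDl.
  by rewrite -ler_pdivlMr.
apply: le_lt_trans (IH _ abs ab0).
by rewrite !normrM ler_wpM2r // !gtr0_norm.
Qed.

(** Finitely many hyperplanes do not cover the space: a vector that suits the tail is moved slightly
    along one that is not orthogonal to the head. *)
Lemma exists_not_orthogonal n (L : seq 'cV[R]_n) :
  {in L, forall b, b != 0} ->
  exists u : 'rV[R]_n, {in L, forall b, (u *m b) 0 0 != 0}.
Proof.
elim: L => [|b L IH] L0; first by exists 0.
have [u uL] := IH (fun c cL => L0 c (@predU1r _ _ _ _ cL)).
have [e eb] : exists e : 'rV[R]_n, (e *m b) 0 0 != 0.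
  have /matrix0Pn[i [j bij]] := L0 b (mem_head b L).
  exists (delta_mx 0 i); rewrite -rowE mxE.
  by rewrite -(ord1 j).
have [t t0 tL] := small_multiplier
  [seq ((u *m c) 0 0, (e *m c) 0 0) | c <- b :: L].
have [ub|ub] := eqVneq ((u *m b) 0 0) 0; last first.
  by exists u => c; rewrite inE => /predU1P[->//|/uL].
exists (u + t *: e) => c cbL; rewrite mulmxDl -scalemxAl mxE [X in _ + X]mxE.
move: cbL; rewrite inE => /predU1P[->|cL].
  by rewrite ub add0r mulf_neq0 // gt_eqF.
have /tL/= : ((u *m c) 0 0, (e *m c) 0 0) \in
    [seq ((u *m c) 0 0, (e *m c) 0 0) | c <- b :: L].
  by apply: map_f; rewrite inE cL orbT.
move=> /(_ (uL _ cL)); apply: contraTneq => /eqP; rewrite addr_eq0 => /eqP ->.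
by rewrite normrN ltxx.
Qed.

(** [p *m invmx W] lists the coordinates of [p] in the rows of [W], so for invertible [W] this is
    decidable membership in the cone of the rows. *)
Definition in_cone {n} (W : 'M[R]_n) (p : 'rV[R]_n) : bool :=
  [forall j, 0 <= (p *m invmx W) 0 j].

Lemma in_coneP n (W : 'M[R]_n) (p : 'rV[R]_n) : W \in unitmx ->
  reflect (exists2 c : 'rV[R]_n, forall j, 0 <= c 0 j & p = c *m W) (in_cone W p).
Proof.
move=> Wu; apply: (iffP forallP) => [h|[c c0 -> j]].
  by exists (p *m invmx W) => //; rewrite mulmxKV.
by rewrite mulmxK.
Qed.

(** The rows of [invmx N] are [u] and a basis of the hyperplane orthogonal to [nu]. Right
    multiplication by [N] gives coordinates in this basis, the first being the pairing with [nu]. *)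
Lemma adapted_basis n (u : 'rV[R]_n.+1) (nu : 'cV[R]_n.+1) :
  (u *m nu) 0 0 = 1 ->
  exists N : 'M[R]_n.+1, [/\ N \in unitmx, col 0 N = nu & row 0 (invmx N) = u].
Proof.
move=> unu.
have unu1 : u *m nu = 1%:M by apply/rowP => i; rewrite !ord1 unu mxE eqxx.
have rk : \rank nu = 1%N.
  apply/eqP; rewrite eqn_leq rank_leq_col /=.
  rewrite lt0n mxrank_eq0; apply: contra_eq_neq unu => ->.
  by rewrite mulmx0 mxE eq_sym oner_eq0.
have [B Bfree Bnu] : exists2 B : 'M[R]_(n, n.+1), row_free B & B *m nu = 0.
  have : \rank (kermx nu) = n by rewrite mxrank_ker rk subn1.
  have := eq_row_base (kermx nu); have := row_base_free (kermx nu).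
  move: (row_base _) => B0 B0free B0E rkE; move: B0 B0free B0E; rewrite rkE => B0 B0free B0E.
  by exists B0 => //; apply/sub_kermxP; rewrite B0E.
pose M : 'M[R]_n.+1 := col_mx u B.
(* Pairing a linear relation between the rows with [nu] kills the coefficient of [u]; freeness of
   [B] kills the others. *)
have Mu : M \in unitmx.
  rewrite -row_free_unit -kermx_eq0; apply/eqP/row_matrixP => i; rewrite row0.
  have : row i (kermx M) *m M = 0 by rewrite -row_mul mulmx_ker row0.
  move: (row i _) => v; rewrite -[v](@hsubmxK _ _ 1 n) /M (@mul_row_col _ _ 1 n) => e.
  have l0 : lsubmx (v : 'M[R]_(1, 1 + n)) = 0.
    have /(congr1 (mulmx^~ nu)) := e.
    by rewrite mulmxDl -!mulmxA Bnu unu1 mulmx0 addr0 mulmx1 mul0mx.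
  move: e; rewrite l0 mul0mx add0r => e.
  have -> : rsubmx (v : 'M[R]_(1, 1 + n)) = 0.
    by apply: (row_free_inj Bfree); rewrite e mul0mx.
  by rewrite row_mx0.
exists (invmx M); split; first by rewrite unitmx_inv.
  have MN : M *m nu = delta_mx 0 0.
    rewrite /M (@mul_col_mx _ 1 n) unu1 Bnu; apply/colP => i; rewrite !mxE.
    case: splitP => j /= ij; rewrite !mxE.
      by rewrite !ord1 andbT eqxx; congr (nat_of_bool _)%:R; apply/esym/eqP/val_inj; rewrite /= ij ord1.
    by case: eqP => // i0; move: ij; rewrite i0.
  by rewrite colE -MN mulKmx.
rewrite invmxK; apply/rowP => j; rewrite !mxE.
by case: splitP => k //= _; rewrite ord1.
Qed.


Lemma col_mul m n p (j : 'I_p) (A : 'M[R]_(m, n)) (B : 'M[R]_(n, p)) :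
  col j (A *m B) = A *m col j B.
Proof. by rewrite !colE mulmxA. Qed.

(** The generators other than row [j], in the coordinates given by [N]. Coordinate 0 is dropped
    because it vanishes when the facet lies in the hyperplane orthogonal to [col 0 N]. *)
Definition facet {n} (W N : 'M[R]_n.+1) (j : 'I_n.+1) : 'M[R]_n :=
  row' j (col' 0 (W *m N)).

Lemma mulmx_omit m n p (v : 'M[R]_(m, n.+1)) (A : 'M[R]_(n.+1, p)) (j : 'I_n.+1) :
  col j v = 0 -> v *m A = col' j v *m row' j A.
Proof.
move=> /matrixP v0; apply/matrixP => i k; rewrite !mxE (bigD1_ord j) //=.
have := v0 i 0; rewrite !mxE => ->; rewrite mul0r add0r.
by apply: eq_bigr => l _; rewrite !mxE.
Qed.

Section Facet.
Variables (n : nat) (W N : 'M[R]_n.+1) (j : 'I_n.+1) (a : R).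
Hypotheses (Wu : W \in unitmx) (Nu : N \in unitmx) (a0 : a != 0).
(** Column [j] of [invmx W] is orthogonal to every row of [W] except row [j], so it is normal to the
    facet opposite row [j]. *)
Hypothesis facet_normal : a^-1 *: col j (invmx W) = col 0 N.

Lemma facet_col0 : col 0 (W *m N) = a^-1 *: delta_mx j 0.
Proof.
by rewrite col_mul -facet_normal -scalemxAr colE mulmxA mulmxV // mul1mx.
Qed.

Lemma facet_row : row' j (W *m N) = row_mx 0 (facet W N j) :> 'M[R]_(n, 1 + n).
Proof.
apply/matrixP => i k; rewrite [RHS]mxE; case: splitP => l kl.
  have -> : k = 0 by apply: val_inj; rewrite /= kl ord1.
  have /matrixP/(_ (lift j i) 0) := facet_col0.
  by rewrite !mxE eq_sym (negPf (neq_lift _ _)) mulr0.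
rewrite !mxE; apply: eq_bigr => m _; congr (_ * N _ _).
by apply: val_inj; rewrite /= kl.
Qed.

(** Column 0 of [W *m N] has the single nonzero entry [a^-1], in row [j]; the determinant is
    expanded along it. *)
Lemma facet_det : `|a| * `|\det W| = `|\det (facet W N j)| / `|\det N|.
Proof.
have dN : `|\det N| != 0 by rewrite normr_eq0 -unitfE -unitmxE.
apply: (canRL (mulfK dN)); rewrite -mulrA -!normrM -det_mulmx.
rewrite (expand_det_col _ 0) (bigD1 j) //= big1 => [|i ij].
  have /matrixP/(_ j 0) := facet_col0; rewrite mxE => ->; rewrite !mxE !eqxx mulr1 addr0.
  by rewrite mulVKf // /cofactor normrM normrX normrN1 expr1n mul1r.
have /matrixP/(_ i 0) := facet_col0; rewrite mxE => ->.
by rewrite !mxE (negPf ij) mulr0 mul0r.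
Qed.

Lemma facet_unit : facet W N j \in unitmx.
Proof.
rewrite unitmxE unitfE -normr_eq0.
have dN : `|\det N| != 0 by rewrite normr_eq0 -unitfE -unitmxE.
have /(congr1 ( *%R^~ `|\det N|)) := facet_det; rewrite /= divfK // => <-.
by rewrite !mulf_neq0 // normr_eq0 // -unitfE -unitmxE.
Qed.

Variable q : 'rV[R]_n.
Let p : 'rV[R]_n.+1 := (row_mx 0 q : 'rV[R]_(1 + n)) *m invmx N.

Lemma facet_normal_coord : (p *m invmx W) 0 j = 0.
Proof.
have : p *m col 0 N = 0.
  rewrite -col_mul mulmxKV //; apply/colP => i; rewrite !mxE.
  by case: splitP => k //; rewrite mxE.
rewrite -facet_normal -scalemxAr -col_mul => /eqP.
rewrite scaler_eq0 invr_eq0 (negPf a0) /= => /eqP/matrixP/(_ 0 0).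
by rewrite !mxE.
Qed.

(** The point [p] of the hyperplane has no component along row [j], so dropping that coordinate
    loses nothing. *)
Lemma facet_coord : q *m invmx (facet W N j) = col' j (p *m invmx W).
Proof.
apply: (canLR (mulmxK facet_unit)).
have e : row_mx 0 q = (p *m invmx W) *m (W *m N) :> 'rV[R]_(1 + n).
  by rewrite mulmxA mulmxKV // /p mulmxKV.
move: e; rewrite (mulmx_omit _ _ _ _ _ j); last first.
  by apply/colP => i; rewrite !ord1 mxE facet_normal_coord mxE.
by rewrite facet_row (@mul_mx_row _ _ _ 1 n) mulmx0 => /eq_row_mx [].
Qed.

End Facet.

Lemma sign_stable (x y : R) : x != 0 -> `|y| < `|x| ->
  (0 <= x + y) = (0 <= x) /\ (0 <= x - y) = (0 <= x).
Proof.
move=> x0; have [x1|x1|/eqP] := ltrgtP 0 x; last by rewrite eq_sym (negPf x0).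
  rewrite (gtr0_norm x1) ltr_norml => /andP[h1 h2].
  by split; lra.
rewrite (ltr0_norm x1) ltr_norml opprK => /andP[h1 h2].
by split; apply/negbTE; rewrite -ltNge; lra.
Qed.

(** Let [p] lie on the hyperplane with normal [col 0 N] and on no other facet hyperplane of the
    cone. A short move along [u] changes membership only through a facet in that hyperplane, and the
    sign of [a j] tells whether the cone is entered or left. *)
Lemma in_cone_jump n (W N : 'M[R]_n.+1) (q : 'rV[R]_n) (t : R) :
  let u : 'rV[R]_n.+1 := row 0 (invmx N) in
  let p : 'rV[R]_n.+1 := (row_mx 0 q : 'rV[R]_(1 + n)) *m invmx N in
  let a k := (u *m invmx W) 0 k in
  W \in unitmx -> N \in unitmx -> 0 < t -> (forall k, a k != 0) ->
  (forall k, (a k)^-1 *: col k (invmx W) != col 0 N -> (p *m invmx W) 0 k != 0) ->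
  (forall k, (p *m invmx W) 0 k != 0 -> `|t * a k| < `|(p *m invmx W) 0 k|) ->
  (in_cone W (p + t *: u))%:R - (in_cone W (p - t *: u))%:R =
  \sum_(j | (a j)^-1 *: col j (invmx W) == col 0 N)
    Num.sg (a j) * (in_cone (facet W N j) q)%:R.
Proof.
move=> u p a Wu Nu t0 a0 gen small.
have addE k : ((p + t *: u) *m invmx W) 0 k = (p *m invmx W) 0 k + t * a k.
  by rewrite mulmxDl -scalemxAl mxE [X in _ + X]mxE.
have subE k : ((p - t *: u) *m invmx W) 0 k = (p *m invmx W) 0 k - t * a k.
  by rewrite mulmxBl -scalemxAl mxE [X in _ + X]mxE [X in - X]mxE.
have [/existsP[j nj]|/existsPn no] :=
    boolP [exists j, (a j)^-1 *: col j (invmx W) == col 0 N]; last first.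
  rewrite big_pred0 => [|j]; last exact/negbTE/no.
  apply/eqP; rewrite subr_eq0; apply/eqP; congr (nat_of_bool _)%:R.
  apply: eq_forallb => k; rewrite addE subE.
  by have [-> ->] := sign_stable _ _ (gen k (no k)) (small k (gen k (no k))).
(* Distinct columns of an invertible matrix are not proportional, so at most one facet spans the
   hyperplane. *)
have uniq_j k : ((a k)^-1 *: col k (invmx W) == col 0 N) = (k == j).
  apply/eqP/eqP => [nk|->]; last exact/eqP.
  apply/eqP; move: nk; rewrite -(eqP nj) => /(congr1 (mulmx W)).
  rewrite -!scalemxAr -!col_mul mulmxV // => /matrixP/(_ k 0); rewrite !mxE eqxx mulr1.
  by case: eqVneq => // _ /eqP; rewrite mulr0 invr_eq0 (negPf (a0 k)).
rewrite (eq_bigl _ _ uniq_j) big_pred1_eq.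
have pj : (p *m invmx W) 0 j = 0.
  by apply: (facet_normal_coord n W N j (a j)) => //; exact/eqP.
have facE : in_cone (facet W N j) q = [forall k, 0 <= (p *m invmx W) 0 (lift j k)].
  apply: eq_forallb => k.
  by rewrite (facet_coord n W N j (a j)) ?mxE //; exact/eqP.
have liftE (Q : pred 'I_n.+1) : [forall k, Q k] = Q j && [forall k, Q (lift j k)].
  apply/forallP/andP => [h|[hj /forallP h] k]; first by split=> //; apply/forallP.
  by case: (unliftP j k) => [l|] ->.
have stable k : (0 <= (p *m invmx W) 0 (lift j k) + t * a (lift j k)) =
     (0 <= (p *m invmx W) 0 (lift j k)) /\
   (0 <= (p *m invmx W) 0 (lift j k) - t * a (lift j k)) =
     (0 <= (p *m invmx W) 0 (lift j k)).
  have pk : (p *m invmx W) 0 (lift j k) != 0.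
    by apply: gen; rewrite uniq_j eq_sym neq_lift.
  exact: sign_stable (small _ pk).
have -> : in_cone W (p + t *: u) = (0 < a j) && in_cone (facet W N j) q.
  rewrite facE /in_cone liftE addE pj add0r pmulr_rge0 // le_eqVlt eq_sym (negPf (a0 j)) /=.
  by congr andb; apply: eq_forallb => k; rewrite addE; have [-> _] := stable k.
have -> : in_cone W (p - t *: u) = (a j < 0) && in_cone (facet W N j) q.
  rewrite facE /in_cone liftE subE pj sub0r oppr_ge0 pmulr_rle0 // le_eqVlt (negPf (a0 j)) /=.
  by congr andb; apply: eq_forallb => k; rewrite subE; have [_ ->] := stable k.
have [aj|aj|aj] := ltrgtP 0 (a j); last by have := a0 j; rewrite -aj eqxx.
  by rewrite gtr0_sg // mul1r subr0.
by rewrite ltr0_sg // mulN1r sub0r.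
Qed.

Lemma sum_fibers (I : finType) (T : eqType) (A : pred I) (f : I -> T) (F : I -> R) :
  \sum_(i | A i) F i =
  \sum_(y <- undup [seq f i | i <- enum I]) \sum_(i | A i && (f i == y)) F i.
Proof.
have -> : \sum_(i | A i) F i =
    \sum_(i | A i) \sum_(y <- undup [seq f i | i <- enum I]) if f i == y then F i else 0.
  apply: eq_bigr => i _; rewrite (bigD1_seq (f i)) ?undup_uniq //=.
    rewrite eqxx big1 ?addr0 // => y; rewrite eq_sym => /negPf -> //.
  by rewrite mem_undup map_f // mem_enum.
by rewrite exchange_big; apply: eq_bigr => y _; rewrite [RHS]big_mkcondr.
Qed.

(** The indicator identity is only required off the hyperplanes in [B], since closed cones that tile
    a region overlap along their boundaries. *)
Lemma cone_valuation n (I : finType) (A : pred I) (c : I -> R)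
    (W : I -> 'M[R]_n) (B : seq 'cV[R]_n) (x : 'cV[R]_n) :
  {in A, forall i, W i \in unitmx} -> {in B, forall b, b != 0} ->
  {in A, forall i j, (W i *m x) j 0 != 0} ->
  (forall p : 'rV[R]_n, {in B, forall b, (p *m b) 0 0 != 0} ->
     \sum_(i | A i) c i * (in_cone (W i) p)%:R = 0) ->
  \sum_(i | A i) c i * (`|\det (W i)| / \prod_j (W i *m x) j 0) = 0.
Proof.
elim: n => [|n IH] in I A c W B x *.
  (* In dimension 0 every cone contains the only point and contributes 1, and no nonzero vector can
     be in [B]. *)
  move=> Wu B0 _ /(_ 0) H; rewrite -[RHS]H; last first.
    by move=> b /B0; rewrite (flatmx0 b) eqxx.
  apply: eq_bigr => i _; rewrite det_mx00 normr1 big_ord0 divr1.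
  by rewrite /in_cone; case: forallP => // -[] [].
move=> Wu B0 Wx H.
have [/existsP[i0 Ai0]|/existsPn noA] := boolP [exists i, A i]; last first.
  by rewrite big_pred0 // => i; exact/negbTE/noA.
have x0 : x != 0.
  by apply: contraTneq (Wx i0 Ai0 0) => ->; rewrite mulmx0 mxE eqxx.
pose F := [seq col ij.2 (invmx (W ij.1)) | ij <- enum {: I * 'I_n.+1} & A ij.1].
have inF i j : A i -> col j (invmx (W i)) \in F.
  move=> Ai; apply: (@map_f _ _ (fun ij => col ij.2 (invmx (W ij.1))) _ (i, j)).
  by rewrite mem_filter Ai mem_enum.
have F0 b : b \in F -> b != 0.
  move=> /mapP[[i j] /=]; rewrite mem_filter => /andP[/= Ai _] ->.
  apply/eqP => /(congr1 (mulmx (W i))).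
  rewrite -col_mul mulmxV ?Wu // mulmx0 => /matrixP/(_ j 0) /eqP.
  by rewrite !mxE eqxx oner_eq0.
(* Genericity against [x] allows division by [<u, x>], against [F] makes all coordinates [a i j]
   nonzero, and against [B] lets small moves along [u] leave the exceptional hyperplanes. *)
have [u uL] : exists u : 'rV[R]_n.+1, {in x :: B ++ F, forall b, (u *m b) 0 0 != 0}.
  apply: exists_not_orthogonal => b; rewrite inE mem_cat => /predU1P[->//|].
  by case/orP => [/B0|/F0].
pose a i j := (u *m invmx (W i)) 0 j.
have aE i j : a i j = (u *m col j (invmx (W i))) 0 0.
  by rewrite -col_mul mxE.
have a0 i j : A i -> a i j != 0.
  by move=> Ai; rewrite aE uL // inE mem_cat inF ?orbT.
have ux0 : (u *m x) 0 0 != 0 by rewrite uL ?mem_head.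
apply: (mulfI ux0); rewrite mulr0.
(* Facet normals are scaled to pair to 1 with [u], so two facets span the same hyperplane exactly
   when their values of [f] agree. *)
pose f (ij : I * 'I_n.+1) := (a ij.1 ij.2)^-1 *: col ij.2 (invmx (W ij.1)).
pose H' (ij : I * 'I_n.+1) := c ij.1 * (a ij.1 ij.2 * `|\det (W ij.1)| /
  \prod_k (W ij.1 *m x) (lift ij.2 k) 0).
(* Expanding [u] in the rows of [W i] cancels the factor of row [j] in the [j]-th term. *)
have -> : (u *m x) 0 0 * \sum_(i | A i) c i * (`|\det (W i)| / \prod_j (W i *m x) j 0) =
    \sum_(ij | A ij.1) H' ij.
  rewrite (eq_bigl (fun ij : I * 'I_n.+1 => A ij.1 && true)); last by move=> ij; rewrite andbT.
  rewrite -(pair_big_dep A (fun _ _ => true) (fun i j => H' (i, j))) /= mulr_sumr.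
  apply: eq_bigr => i Ai; rewrite /H' /= mulrCA -mulr_sumr; congr (_ * _).
  rewrite -{1}(mulmxKV (Wu i Ai) u) -(mulmxA _ (W i) x) mxE mulr_suml; apply: eq_bigr => j _.
  rewrite (bigD1_ord j) //= -/(a i j).
  have := Wx i Ai j; set w := (W i *m x) j 0; set P := \prod_k _ => w0.
  rewrite invfM; set D := `|_|.
  rewrite -[RHS]mulr1 -(divff w0); ring.
rewrite (sum_fibers _ _ _ f) big1_seq // => y _.
have [/existsP[[i1 j1] /= /andP[Ai1 /eqP f1]]|/existsPn none] :=
    boolP [exists ij, A ij.1 && (f ij == y)]; last first.
  by rewrite big_pred0 // => ij; exact/negbTE/none.
have uy : (u *m y) 0 0 = 1.
  by rewrite -f1 -scalemxAr mxE -aE mulVf // a0.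
have [N [Nu Ny Nrow]] := adapted_basis _ _ _ uy.
have ubN (b : 'cV_n.+1) : (u *m b) 0 0 = (invmx N *m b) 0 0.
  by rewrite -Nrow -row_mul mxE.
(* Facet normals restricted to the hyperplane orthogonal to [y]; those that become zero are the
   multiples of [y]. *)
pose B' := [seq v <- [seq row' 0 (invmx N *m b) | b <- F] | v != 0].
pose c' (ij : I * 'I_n.+1) := c ij.1 * Num.sg (a ij.1 ij.2).
pose W' (ij : I * 'I_n.+1) := facet (W ij.1) N ij.2.
have fy (ij : I * 'I_n.+1) : f ij == y -> f ij = col 0 N by move=> /eqP ->.
have W'x (ij : I * 'I_n.+1) k : A ij.1 -> f ij == y ->
    (W' ij *m row' 0 (invmx N *m x)) k 0 = (W ij.1 *m x) (lift ij.2 k) 0.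
  case: ij => i j /= Ai fij.
  have facN : row' j (W i *m N) = row_mx 0 (facet (W i) N j) :> 'M[R]_(n, 1 + n).
    by apply: (facet_row _ _ _ _ (a i j)); [exact: Wu|exact: (fy (i, j))].
  have -> : (W i *m x) (lift j k) 0 = (row' j (W i *m N) *m (invmx N *m x)) k 0.
    have -> : row' j (W i *m N) *m (invmx N *m x) = row' j (W i *m N *m (invmx N *m x)).
      by apply/matrixP => r s; rewrite !mxE; apply: eq_bigr => l _; rewrite [in LHS]mxE.
    by rewrite mulmxA mulmxK // [RHS]mxE.
  rewrite (mulmx_omit _ _ _ _ _ 0).
    by congr ((_ *m _) _ _); apply/matrixP => r s; rewrite !mxE.
  rewrite facN; apply/colP => r; rewrite !mxE.
  by case: splitP => l //; rewrite mxE.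
have {}IH := IH _ (fun ij => A ij.1 && (f ij == y)) c' W' B' (row' 0 (invmx N *m x)).
transitivity (`|\det N|^-1 * \sum_(ij | A ij.1 && (f ij == y))
    c' ij * (`|\det (W' ij)| / \prod_j (W' ij *m row' 0 (invmx N *m x)) j 0)).
  rewrite mulr_sumr; apply: eq_bigr => -[i j] /andP[/= Ai fij].
  rewrite (eq_bigr _ (fun k _ => W'x (i, j) k Ai fij)).
  have := facet_det _ _ _ _ _ (Wu i Ai) Nu (a0 i j Ai) (fy _ fij).
  rewrite /H' /c' /W' /= [in a i j * _](numEsg (a i j)) -[_ * _ * `|\det _|]mulrA => ->.
  by ring.
rewrite IH ?mulr0 //.
- move=> ij /andP[Ai fij].
  by apply: (facet_unit _ _ _ _ (a ij.1 ij.2)); [exact: Wu|exact: Nu|exact: a0|exact: fy].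
- by move=> b; rewrite mem_filter => /andP[].
- by move=> ij /andP[Ai fij] k; rewrite W'x ?Wx.
move=> q qB'.
pose p : 'rV[R]_n.+1 := (row_mx 0 q : 'rV[R]_(1 + n)) *m invmx N.
have pE (b : 'cV_n.+1) : (p *m b) 0 0 = (q *m row' 0 (invmx N *m b)) 0 0.
  rewrite -mulmxA (mulmx_omit _ _ _ (row_mx 0 q : 'M[R]_(1, 1 + n)) _ 0); last first.
    by apply/colP => r; rewrite !mxE; case: splitP => l //; rewrite mxE.
  congr ((_ *m _) _ _); apply/rowP => r; rewrite !mxE.
  case: splitP => l; first by rewrite ord1.
  by move=> /= e; congr (q _ _); apply: val_inj; case: e.
have [t t0 tP] := small_multiplier [seq ((p *m b) 0 0, (u *m b) 0 0) | b <- B ++ F].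
have {}tP b : b \in B ++ F -> (p *m b) 0 0 != 0 -> `|t * (u *m b) 0 0| < `|(p *m b) 0 0|.
  by move=> bB; apply: (tP ((p *m b) 0 0, (u *m b) 0 0)); apply: map_f.
have pm b : b \in B -> ((p + t *: u) *m b) 0 0 != 0 /\ ((p - t *: u) *m b) 0 0 != 0.
  move=> bB; have ub : (u *m b) 0 0 != 0 by rewrite uL // inE mem_cat bB orbT.
  have -> : ((p + t *: u) *m b) 0 0 = (p *m b) 0 0 + t * (u *m b) 0 0.
    by rewrite mulmxDl -scalemxAl mxE [X in _ + X]mxE.
  have -> : ((p - t *: u) *m b) 0 0 = (p *m b) 0 0 - t * (u *m b) 0 0.
    by rewrite mulmxBl -scalemxAl mxE [X in _ + X]mxE [X in - X]mxE.
  (* A point [p] lying on a hyperplane of [B] is pushed off it by [u]; otherwise the step is too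
     short to reach it. *)
  have [->|pb] := eqVneq ((p *m b) 0 0) 0.
    by rewrite add0r sub0r oppr_eq0; split; rewrite mulf_neq0 // gt_eqF.
  have {tP} := tP b _ pb; rewrite mem_cat bB => /(_ isT) tb.
  split; apply: contraTneq tb.
    by move=> /eqP; rewrite addr_eq0 => /eqP ->; rewrite normrN ltxx.
  by move=> /eqP; rewrite subr_eq0 => /eqP ->; rewrite ltxx.
(* The indicator identity holds on both sides of the hyperplane; the difference is the identity for
   the facets. *)
transitivity (\sum_(i | A i) c i * ((in_cone (W i) (p + t *: u))%:R -
    (in_cone (W i) (p - t *: u))%:R)); last first.
  under eq_bigr => i _ do rewrite mulrBr.
  by rewrite sumrB !H ?subrr // => b /pm[].
rewrite -(pair_big_dep A (fun i j => f (i, j) == y)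
  (fun i j => c' (i, j) * (in_cone (W' (i, j)) q)%:R)) /=.
apply: eq_bigr => i Ai; have := in_cone_jump n (W i) N q t.
rewrite Nrow -/p /= => ->; rewrite ?Wu //.
- by rewrite mulr_sumr Ny; apply: eq_bigr => j _; rewrite /c' mulrA.
- by move=> k; exact: a0.
(* If [p] is on the hyperplane of facet [k], genericity of [q] forces the normal of that facet to
   restrict to zero, hence to be a multiple of [y]. *)
- move=> k; rewrite -/(a i k); apply: contraNneq => pk0.
  have colk : (p *m col k (invmx (W i))) 0 0 = 0 by rewrite -col_mul mxE.
  have v0 : row' 0 (invmx N *m col k (invmx (W i))) = 0.
    apply/eqP/negPn/negP => v0; have := qB' (row' 0 (invmx N *m col k (invmx (W i)))).
    rewrite -pE colk eqxx mem_filter v0 => h.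
    by have := h (map_f (fun b => row' 0 (invmx N *m b)) (inF i k Ai)).
  have e : invmx N *m col k (invmx (W i)) = a i k *: delta_mx 0 0.
    apply/colP => r; case: (unliftP 0 r) => [l|] ->.
      have /matrixP/(_ l 0) := v0; rewrite mxE => ->.
      by rewrite !mxE eq_sym (negPf (neq_lift _ _)) mulr0.
    by rewrite -ubN -aE !mxE !eqxx mulr1.
  rewrite -[col k _](mulKVmx Nu) e -scalemxAr -colE scalerA mulVf ?scale1r //.
  exact: a0.
- move=> k; have := tP (col k (invmx (W i))).
  by rewrite mem_cat inF ?orbT // -aE -col_mul mxE; apply.
Qed.
End Valuation.

(** * Linear programs attain their minimum *)

Section PolyhedronMin.
Context {R : realType} {d : nat}.
Implicit Types (P F C : set 'rV[R]_d) (v y z : 'rV[R]_d).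

Lemma dotvE v y : dotv v y = (v *m y^T) 0 0.
Proof. by rewrite mxE; apply: eq_bigr => i _; rewrite mxE. Qed.

Lemma dotvDr v y z : dotv v (y + z) = dotv v y + dotv v z.
Proof. by rewrite !dotvE linearD mulmxDr mxE. Qed.

Lemma dotvZr v (t : R) y : dotv v (t *: y) = t * dotv v y.
Proof. by rewrite !dotvE linearZ -scalemxAr mxE. Qed.

Lemma dotvBr v y z : dotv v (y - z) = dotv v y - dotv v z.
Proof. by rewrite -scaleN1r dotvDr dotvZr mulN1r. Qed.

Lemma dotv_suml (I : finType) (c : I -> R) (u : I -> 'rV[R]_d) y :
  dotv (\sum_i c i *: u i) y = \sum_i c i * dotv (u i) y.
Proof.
rewrite dotvE mulmx_suml summxE; apply: eq_bigr => i _.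
by rewrite -scalemxAl mxE -dotvE.
Qed.

Section LinearProgram.
Variables (I : finType) (a : I -> 'rV[R]_d) (b : I -> R) (v : 'rV[R]_d).

Definition feasible y := forall i, b i <= dotv (a i) y.

Definition active y : {set I} := [set i | dotv (a i) y == b i]%SET.

(** Zero rows stand for the constraints outside [A], so the size is independent of [A]; the row
    space is spanned by the normals in [A]. *)
Definition active_mx (A : {set I}) : 'M[R]_(#|I|, d) :=
  \matrix_(i < #|I|) (if enum_val i \in A then a (enum_val i) else 0).

(* Moving along a direction orthogonal to the active constraints keeps them
   tight; it stops when a further constraint becomes tight. *)
Lemma descend (m : R) y : feasible y -> (forall x, feasible x -> m <= dotv v x) ->
  exists y', [/\ feasible y', dotv v y' <= dotv v y &
    (v <= active_mx (active y'))%MS].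
Proof.
have [k] := ubnP #|~: active y|.
elim: k y => // k IH y; rewrite ltnS => yk Py Pm.
have [vact|] := boolP (v <= active_mx (active y))%MS; first by exists y.
rewrite submxE => /matrix0Pn[i0 [j]]; rewrite ord1 => {i0} vj.
(* A column of the cokernel is orthogonal to the active normals; this one is not orthogonal to
   [v]. *)
pose u0 := (col j (cokermx (active_mx (active y))))^T.
have vu0 : dotv v u0 != 0 by rewrite dotvE trmxK colE mulmxA -colE mxE.
have act0 i : i \in active y -> dotv (a i) u0 = 0.
  move=> iact; have := mulmx_coker (active_mx (active y)).
  move=> /matrixP/(_ (enum_rank i) j) e.
  rewrite dotvE trmxK; move: e; rewrite !mxE; apply: etrans.
  by apply: eq_bigr => l _; rewrite !mxE enum_rankK iact.
pose u := - Num.sg (dotv v u0) *: u0.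
have vu : dotv v u < 0.
  by rewrite dotvZr mulNr oppr_lt0 -normrEsg normr_gt0.
have actu i : i \in active y -> dotv (a i) u = 0.
  by move=> /act0 e; rewrite dotvZr e mulr0.
have [i1 i1u] : exists i, dotv (a i) u < 0.
  apply/not_existsP => nex.
  (* Without a blocking constraint, this step would bring the objective down to [m - 1]. *)
  pose t := (dotv v y - m + 1) / - dotv v u.
  have vut : t * dotv v u = - (dotv v y - m + 1).
    by rewrite /t invrN mulrN mulNr divfK // lt_eqF.
  have t0 : 0 <= t.
    by rewrite divr_ge0 // ?oppr_ge0 ?(ltW vu) // addr_ge0 // subr_ge0 Pm.
  have /Pm : feasible (y + t *: u).
    move=> i; rewrite dotvDr dotvZr; apply: le_trans (Py i) _; rewrite lerDl mulr_ge0 //.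
    by rewrite leNgt; apply/negP => iu; apply: (nex i).
  by rewrite dotvDr dotvZr vut; lra.
(* Ratio test: the step length at which constraint [i] becomes tight. *)
pose step i := (dotv (a i) y - b i) / - dotv (a i) u.
pose i2 := [arg min_(i < i1 | dotv (a i) u < 0) step i]%O.
have [i2u i2min] : dotv (a i2) u < 0 /\
    forall i, dotv (a i) u < 0 -> step i2 <= step i.
  by rewrite /i2; case: arg_minP => // i iu imin; split.
have step0 : 0 <= step i2.
  by rewrite divr_ge0 // ?oppr_ge0 ?(ltW i2u) // subr_ge0.
pose y1 := y + step i2 *: u.
have Py1 : feasible y1.
  move=> i; rewrite dotvDr dotvZr.
  have [iu|iu] := ltP (dotv (a i) u) 0; last first.
    by apply: le_trans (Py i) _; rewrite lerDl mulr_ge0.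
  have := i2min i iu; rewrite {2}/step ler_pdivlMr ?oppr_gt0 //.
  by rewrite mulrN; lra.
have y1v : dotv v y1 <= dotv v y.
  by rewrite dotvDr dotvZr gerDl mulr_ge0_le0 // ltW.
have y1lt : (#|~: active y1| < k)%N.
  apply: leq_trans yk; apply: proper_card; apply/properP; split.
    rewrite finset.setCS; apply/fintype.subsetP => i ia; rewrite inE dotvDr dotvZr actu // mulr0 addr0.
    by move: ia; rewrite inE.
  exists i2; rewrite !inE; first by apply: contraTneq i2u => e; rewrite actu ?ltxx // inE e.
  rewrite negbK dotvDr dotvZr /step invrN mulrN mulNr divfK ?(lt_eqF i2u) //.
  by apply/eqP; lra.
have [y' [Py' y'y y'act]] := IH _ y1lt Py1 Pm.
by exists y'; split=> //; apply: le_trans y'y _.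
Qed.

(** [v] is a combination of active normals, and these take the prescribed values [b i] at both
    points. *)
Lemma active_value y1 y2 : active y1 = active y2 ->
  (v <= active_mx (active y1))%MS -> dotv v y1 = dotv v y2.
Proof.
move=> y12 /submxP[w ->]; rewrite !dotvE -!mulmxA; congr ((_ *m _) _ _).
apply/colP => i.
have e y : active y = active y1 -> (active_mx (active y1) *m y^T) i 0 =
    if enum_val i \in active y1 then b (enum_val i) else 0.
  move=> <-; rewrite mxE; case: ifPn => [iy|iy].
    move: (iy); rewrite inE => /eqP <-; rewrite dotvE mxE.
    by apply: eq_bigr => j _; rewrite mxE iy.
  by rewrite big1 // => j _; rewrite !mxE (negPf iy) mxE mul0r.
by rewrite !e.
Qed.

(** By [descend] only points whose active normals span [v] matter. Their value depends on the active
    set alone, so finitely many values compete. *)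
Lemma linear_program_min (m : R) y : feasible y ->
  (forall x, feasible x -> m <= dotv v x) ->
  exists2 y0, feasible y0 & forall x, feasible x -> dotv v y0 <= dotv v x.
Proof.
move=> Py Pm.
pose S (A : {set I}) := [set x | [/\ feasible x, active x = A & (v <= active_mx A)%MS]].
(* The default [y] is harmless: the minimum below runs over the sets [A] with [S A (x0 A)]. *)
pose x0 A := xget y (S A).
have SE A x : S A x -> S A (x0 A) /\ dotv v x = dotv v (x0 A).
  move=> Sx; have S0 : S A (x0 A) by apply: (xgetPex y); exists x.
  split=> //; case: Sx S0 => _ xA vA [_ x0A _].
  by apply: active_value; rewrite ?xA ?x0A.
have [y1 [Py1 _ vy1]] := descend m y Py Pm.
have Sy1 : S (active y1) y1 by [].
have := @arg_minP _ _ _ (active y1) (fun A => `[< S A (x0 A) >]) (fun A => dotv v (x0 A)).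
case=> [|A /asboolP[PA _ _] Amin]; first by apply/asboolP; exact: (SE _ _ Sy1).1.
exists (x0 A) => // x Px.
have [x' [Px' x'x vx']] := descend m x Px Pm.
have Sx' : S (active x') x' by [].
have [S0 e] := SE _ _ Sx'.
by apply: le_trans x'x; rewrite e; apply: Amin; apply/asboolP.
Qed.

End LinearProgram.

Lemma polyhedron_min P v (m : R) : polyhedron P ->
  (forall x, P x -> m <= dotv v x) ->
  exists2 y0, P y0 & forall x, P x -> dotv v y0 <= dotv v x.
Proof.
move=> [[y Py] [s [_ PE]]]; rewrite {}PE in Py *.
pose I := 'I_(size s); pose h (i : I) := tnth (in_tuple s) i.
have E : [set y | forall h, h \in s -> halfspace h.1 h.2 y] =
    [set y | feasible I (fun i => (h i).1) (fun i => (h i).2) y].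
  apply/seteqP; split=> x /= H; first by move=> i; apply: H; exact: mem_tnth.
  by move=> g /(tnthP (in_tuple s))[i ->]; exact: H.
move: Py; rewrite E => Py Pm.
exact: (linear_program_min _ _ _ _ m y).
Qed.

End PolyhedronMin.

(** * The dual cone and triangulations of the normal fan *)

Section DualCone.
Context {R : realType} {d : nat}.
Implicit Types (P F C : set 'rV[R]_d) (v y z : 'rV[R]_d) (w : 'rV[R]_(1 + d)).

Definition affine (w : 'rV[R]_(1 + d)) y : R := (w *m (row_mx 1%:M y)^T) 0 0.

Definition dual_cone P : set 'rV[R]_(1 + d) :=
  [set w | forall y, P y -> 0 <= affine w y].

Lemma affineE w y : affine w y = lsubmx w 0 0 + dotv (rsubmx w) y.
Proof.
rewrite /affine -{1}[w]hsubmxK tr_row_mx mul_row_col mxE -(dotvE (rsubmx w)).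
by rewrite trmx1 mulmx1.
Qed.

Lemma affine_row_mx (a : 'rV[R]_1) v y : affine (row_mx a v) y = a 0 0 + dotv v y.
Proof. by rewrite affineE row_mxKl row_mxKr. Qed.

Lemma support_fun_min P v y : P y -> (forall x, P x -> dotv v y <= dotv v x) ->
  support_fun P v = (- dotv v y)%:E.
Proof.
move=> Py ymin; rewrite /support_fun EFinN; congr (- _)%E.
apply/eqP; rewrite eq_le; apply/andP; split.
  by apply: ge_ereal_inf; exists (dotv v y)%:E => //; exists y.
by apply: le_ereal_inf_tmp => _ [x Px <-]; rewrite lee_fin ymin.
Qed.

Lemma support_fun_le P v y x : support_fun P v = (- dotv v y)%:E -> P x ->
  dotv v y <= dotv v x.
Proof.
rewrite /support_fun EFinN => /eqe_oppP e Px.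
by rewrite -lee_fin -e; apply: ge_ereal_inf; exists (dotv v x)%:E => //; exists x.
Qed.

Lemma in_simplicial_cone (A : 'M[R]_d) v : A \in unitmx ->
  simplicial_cone A v <-> in_cone A v.
Proof.
move=> Au; split.
  move=> [c [c0 ->]]; apply/in_coneP => //; exists (\row_j c j).
    by move=> j; rewrite mxE.
  rewrite mulmx_sum_row; apply: eq_big => [j|j _]; rewrite ?inE ?mxE //.
move=> /in_coneP [//|c c0 ->]; exists (fun j => c 0 j); split => //.
by rewrite mulmx_sum_row; apply: eq_bigl => j; rewrite inE.
Qed.

Lemma row_cone_face (A : 'M[R]_d) (S : {set 'I_d}) v : A \in unitmx ->
  row_cone A S v -> S <> [set: 'I_d]%SET ->
  exists j, (v *m col j (invmx A)) 0 0 = 0.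
Proof.
move=> Au [c [_ ->]] ST.
have [j jS] : exists j, j \notin S.
  apply/not_existsP => h; apply: ST; apply/setP => j; rewrite !inE.
  by apply/negPn/negP => jS; exact: (h j).
exists j; have -> : \sum_(j in S) c j *: row j A = (\row_j (if j \in S then c j else 0)) *m A.
  rewrite mulmx_sum_row big_mkcond; apply: eq_bigr => k _; rewrite mxE.
  by case: ifP => //; rewrite scale0r.
by rewrite -col_mul mulmxK // !mxE (negPf jS).
Qed.

(** When finite, [support_fun P v] is the least constant term making the form with linear part [v]
    nonnegative on [P]; row 0 is the constant form 1. *)
Definition lift_mx P (A : 'M[R]_d) : 'M[R]_(1 + d) :=
  block_mx 1%:M 0 (\col_j fine (support_fun P (row j A))) A.

Lemma det_lift_mx P A : \det (lift_mx P A) = \det A.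
Proof. by rewrite det_lblock det1 mul1r. Qed.

Lemma lift_mx_unit P A : A \in unitmx -> lift_mx P A \in unitmx.
Proof. by rewrite !unitmxE det_lift_mx. Qed.

Lemma lift_mx_factors P A z :
  \prod_j (lift_mx P A *m (row_mx 1%:M z)^T) j 0 =
  \prod_j dual_factor P (row j A) z.
Proof.
rewrite tr_row_mx mul_block_col trmx1 !mulmx1 mul0mx addr0 big_split_ord /=.
rewrite big_ord1 col_mxEu mxE eqxx mul1r; apply: eq_bigr => j _.
rewrite col_mxEd !mxE /dual_factor; congr (_ + _).
by apply: eq_bigr => k _; rewrite !mxE.
Qed.

Lemma dual_volumeE P n (T : 'I_n -> 'M[R]_d) z : dual_volume P T z =
  \sum_i `|\det (lift_mx P (T i))| / \prod_j (lift_mx P (T i) *m (row_mx 1%:M z)^T) j 0.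
Proof.
by apply: eq_bigr => i _; rewrite det_lift_mx lift_mx_factors.
Qed.

(** On a normal cone the support function is linear, equal to minus the pairing with a point [y] of
    the face. A form in the dual cone exceeds the lift of its linear part by its value at [y], which
    is the coefficient of [(1, 0)]. *)
Lemma in_cone_lift_mx P F A w : A \in unitmx -> poly_face P F ->
  simplicial_cone A `<=` normal_cone P F ->
  in_cone (lift_mx P A) w = `[< dual_cone P w >] && in_cone A (rsubmx w).
Proof.
move=> Au [[y Fy] [v0 FE]] AF.
have Py : P y by move: Fy; rewrite FE => -[].
have supp v : in_cone A v -> support_fun P v = (- dotv v y)%:E.
  by move=> /(in_simplicial_cone _ _ Au)/AF [_]; apply.
have hE (c : 'rV[R]_d) : c *m (\col_j fine (support_fun P (row j A))) = (- dotv (c *m A) y)%:M.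
  apply/rowP => i; rewrite !ord1 [LHS]mxE (mulmx_sum_row _ A) dotv_suml !mxE eqxx mulr1n -sumrN.
  apply: eq_bigr => j _; rewrite mxE (supp (row j A)) ?mulrN //.
  apply/in_coneP => //; exists (delta_mx 0 j); last by rewrite -rowE.
  by move=> k; rewrite mxE ler0n.
apply/idP/andP.
  move=> /(in_coneP _ _ _ (lift_mx_unit P A Au))[c c0 wE].
  have cl j : 0 <= (rsubmx c) 0 j by rewrite mxE.
  have cA : in_cone A (rsubmx c *m A) by apply/in_coneP => //; exists (rsubmx c).
  have {}wE : w = row_mx (lsubmx c + (- dotv (rsubmx c *m A) y)%:M) (rsubmx c *m A).
    by rewrite wE -{1}[c]hsubmxK mul_row_block hE mulmx1 mulmx0 add0r.
  split; last by rewrite wE row_mxKr.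
  apply/asboolP => x Px; rewrite wE affine_row_mx !mxE eqxx mulr1n.
  rewrite -addrA addr_ge0 // addrC subr_ge0.
  exact: (support_fun_le _ _ _ _ (supp _ cA)).
move=> [/asboolP/(_ y Py) wy wA]; apply/in_coneP; first exact: lift_mx_unit.
have [c c0 wr] := in_coneP _ _ _ Au wA.
exists (row_mx (affine w y)%:M c).
  move=> j; rewrite mxE; case: splitP => k _ //.
  by rewrite ord1 mxE eqxx.
rewrite mul_row_block hE mulmx1 mulmx0 add0r -wr -{1}[w]hsubmxK; congr row_mx.
by apply/rowP => i; rewrite !ord1 !mxE affineE !eqxx !mulr1n addrK mxE.
Qed.

(** A form nonnegative on [P] has its linear part bounded below, so the minimum is attained and the
    linear part lies in the fan. Genericity keeps it off proper faces, hence in a single cone. *)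
Lemma triangulation_dual_cone P n (T : 'I_n -> 'M[R]_d) w :
  polyhedron P -> fan_triangulation (normal_fan P) T ->
  (forall i j, (rsubmx w *m col j (invmx (T i))) 0 0 != 0) ->
  \sum_i (in_cone (lift_mx P (T i)) w)%:R = `[< dual_cone P w >]%:R :> R.
Proof.
move=> Ppoly [Tu _ TN Tcover Tinter] gen.
have liftE i : in_cone (lift_mx P (T i)) w = `[< dual_cone P w >] && in_cone (T i) (rsubmx w).
  have [_ [F PF ->]] := TN i.
  exact: (in_cone_lift_mx _ _ _ _ (Tu i) PF).
under eq_bigr => i _ do rewrite liftE.
case: asboolP => [wP|_]; last by rewrite big1.
have [i iw] : exists i, in_cone (T i) (rsubmx w).
  have [|y Py ymin] := polyhedron_min P (rsubmx w) (- lsubmx w 0 0) Ppoly.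
    by move=> x /wP; rewrite affineE => h; lra.
  have supp := support_fun_min P (rsubmx w) y Py ymin.
  have : (\bigcup_(C in normal_fan P) C) (rsubmx w).
    exists (normal_cone P [set x | P x /\ forall x', P x' -> dotv (rsubmx w) x <= dotv (rsubmx w) x']).
      eexists; last by [].
      split; first by exists y.
      by exists (rsubmx w).
    split=> [|x [Px xmin]]; first by rewrite supp.
    exact: support_fun_min.
  by rewrite -Tcover => -[i _ /(in_simplicial_cone _ _ (Tu i))]; exists i.
rewrite (bigD1 i) //= iw big1 ?addr0 // => k ki.
case: (boolP (in_cone (T k) _)) => // kw; exfalso.
have ik : i != k by rewrite eq_sym.
have [neq [S [S' [SE S'E]]]] := Tinter i k ik.
have : (simplicial_cone (T i) `&` simplicial_cone (T k)) (rsubmx w).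
  by split; apply/in_simplicial_cone.
(* If [S] and [S'] were both full, the two cones would coincide; so one of the two faces is
   proper. *)
rewrite SE => wS; have [ST|ST] := pselect (S = [set: 'I_d]%SET); last first.
  have [j /eqP] := row_cone_face _ _ _ (Tu i) wS ST.
  by rewrite (negPf (gen i j)).
move: wS; rewrite S'E => wS'.
have [j /eqP] : exists j, (rsubmx w *m col j (invmx (T k))) 0 0 = 0.
  apply: row_cone_face (Tu k) wS' _ => S'T; apply: neq.
  by move: S'E; rewrite ST S'T.
by rewrite (negPf (gen k j)).
Qed.
End DualCone.

(** * Projective images of polyhedra *)

Section ProjectiveImage.
Local Open Scope quotient_scope.
Context {R : realType} {d : nat}.
Implicit Types (P : set 'rV[R]_d) (y z : 'rV[R]_d) (w q : 'rV[R]_(1 + d)).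

Lemma mulmx_continuous m n (A : 'M[R]_(m, n)) :
  continuous (fun x : 'rV[R]_m => x *m A : 'rV[R]_n).
Proof.
have -> : (fun x : 'rV[R]_m => x *m A) = fun x => \sum_i x 0 i *: row i A.
  by apply/funext => x; rewrite mulmx_sum_row.
apply: continuous_big => [|i _ x]; first exact: add_continuous.
by apply: (cvgZr_tmp (F := nbhs x)); exact: coord_continuous.
Qed.

(** A product of two linear forms is homogeneous of degree 2, so its sign is well defined on
    projective points, and negativity is an open condition. *)
Lemma projclosure_sign P q (q0 : q != 0) w1 w2 :
  projclosure P (hompt q0) -> dual_cone P w1 -> dual_cone P w2 ->
  0 <= (w1 *m q^T) 0 0 * (w2 *m q^T) 0 0.
Proof.
move=> Pq w1P w2P.
pose f (u : 'rV[R]_(1 + d)) := (u *m w1^T) 0 0 * (u *m w2^T) 0 0.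
have fE u : (w1 *m u^T) 0 0 * (w2 *m u^T) 0 0 = f u.
  by rewrite /f -[w1 in LHS]trmxK -[w2 in LHS]trmxK -!trmx_mul !mxE.
have lin w : continuous (fun u : 'rV[R]_(1 + d) => (u *m w^T) 0 0).
  move=> u; have := @coord_continuous R 1 1 0 0 (u *m w^T).
  exact: (cvg_comp _ _ (@mulmx_continuous _ _ w^T u)).
have f_cont : continuous f.
  by move=> u; apply: (cvgM (F := nbhs u)); exact: lin.
have f_neg u v : (u <= v)%MS -> f u < 0 -> f v < 0.
  move=> /sub_rVP[a ->]; rewrite /f -!scalemxAl !mxE mulrACA -expr2 => h.
  by rewrite ltNge; apply: contraTN h => h; rewrite -leNgt mulr_ge0 ?sqr_ge0.
rewrite fE leNgt; apply/negP => fq.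
pose U := [set p : projspace R d | f (set_val (repr p)) < 0].
have fU (u : homvec R d) : U (\pi_(projspace R d) u) <-> f (set_val u) < 0.
  rewrite /U /=; have /eqmodP/eqmxP e := reprK (\pi_(projspace R d) u).
  split; apply: f_neg; first by rewrite e.
  by rewrite -e.
have oU : open U.
  have -> : open U = open ((\pi_(projspace R d) : homvec R d -> _) @^-1` U) by [].
  have -> : (\pi_(projspace R d) : homvec R d -> _) @^-1` U =
      (f \o (set_val : homvec R d -> _)) @^-1` [set x | x < 0].
    by apply/seteqP; split=> u /fU.
  apply: open_comp; last exact: open_lt.
  move=> u _; apply: continuous_comp; last exact: f_cont.
  exact: initial_continuous.
have qU : U (hompt q0) by apply/fU.
have [_ [[y Py <-]]] := Pq U (open_nbhs_nbhs (conj oU qU)).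
move=> /fU; rewrite -fE ltNge mulr_ge0 //; [exact: w1P|exact: w2P].
Qed.

(** The homogeneous coordinate whose zero set is the hyperplane at infinity. *)
Definition height : 'rV[R]_(1 + d) := row_mx 1%:M 0.

Lemma heightE q : (height *m q^T) 0 0 = lsubmx q 0 0.
Proof.
rewrite -{1}[q]hsubmxK tr_row_mx mul_row_col mul0mx addr0 mul1mx !mxE.
by congr (q _ _).
Qed.

Lemma affine_height y : affine height y = 1.
Proof. by rewrite /affine heightE row_mxKl mxE eqxx. Qed.

Lemma dual_cone_height P : dual_cone P height.
Proof. by move=> y _; rewrite affine_height ler01. Qed.

Lemma affine_mul_tr (G : 'M[R]_(1 + d)) w y :
  affine (w *m G^T) y = (w *m (homimage G y)^T) 0 0.
Proof. by rewrite /affine /homimage trmx_mul mulmxA. Qed.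

Lemma chart_denomE (G : 'M[R]_(1 + d)) y :
  chart_denom G y = affine (height *m G^T) y.
Proof. by rewrite affine_mul_tr heightE. Qed.

Lemma affine_comb w y1 y2 (t : R) :
  affine w ((1 - t) *: y1 + t *: y2) = (1 - t) * affine w y1 + t * affine w y2.
Proof. by rewrite !affineE dotvDr !dotvZr; ring. Qed.

Lemma chart_mapE (G : 'M[R]_(1 + d)) z : chart_denom G z != 0 ->
  row_mx 1%:M (chart_map G z) = (chart_denom G z)^-1 *: homimage G z.
Proof.
move=> z0; rewrite -[homimage G z in RHS]hsubmxK scale_row_mx; congr row_mx.
apply/rowP => i; rewrite !ord1 -/(chart_denom G z) mxE eqxx.
by rewrite [in RHS]mxE mulVf.
Qed.

Lemma polyhedron_dual P : polyhedron P ->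
  exists s : seq 'rV[R]_(1 + d), forall y, P y <-> forall w, w \in s -> 0 <= affine w y.
Proof.
move=> [_ [s [_ ->]]].
exists [seq row_mx (- h.2)%:M h.1 | h <- s] => y; split.
  move=> H _ /mapP[h hs ->]; rewrite affine_row_mx mxE eqxx mulr1n addrC subr_ge0.
  exact: H.
move=> H h hs; have := H _ (map_f (fun h => row_mx (- h.2)%:M h.1) hs).
by rewrite affine_row_mx mxE eqxx mulr1n addrC subr_ge0.
Qed.

Lemma polyhedron_convex P y1 y2 (t : R) : polyhedron P -> P y1 -> P y2 ->
  0 <= t -> t <= 1 -> P ((1 - t) *: y1 + t *: y2).
Proof.
move=> /polyhedron_dual[s PE] /PE P1 /PE P2 t0 t1; apply/PE => w ws.
by rewrite affine_comb addr_ge0 // mulr_ge0 ?P1 ?P2 // subr_ge0.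
Qed.

Lemma polyhedron_closed P y : polyhedron P -> projclosure P (chart y) -> P y.
Proof.
move=> /polyhedron_dual[s PE] Py; apply/PE => w ws.
have := projclosure_sign _ _ _ w height Py.
rewrite -/(affine _ _) -/(affine _ _) affine_height mulr1; apply.
  by move=> x /PE; apply.
exact: dual_cone_height.
Qed.

Section Image.
Variables (P P' : set 'rV[R]_d) (G : 'M[R]_(1 + d)) (hG : G \in unitmx).
Hypotheses (hP : polyhedron P) (hP' : polyhedron P').
Hypothesis hPP' : projclosure P' = projact hG @` projclosure P.

(** The preimage of [y'] lies in the projective closure of [P]; changing representatives multiplies
    the product by a square. *)
Lemma image_sign y' w1 w2 : P' y' -> dual_cone P w1 -> dual_cone P w2 ->
  0 <= (w1 *m (row_mx 1%:M y' *m invmx G)^T) 0 0 *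
       (w2 *m (row_mx 1%:M y' *m invmx G)^T) 0 0.
Proof.
move=> Py' w1P w2P.
have : projclosure P' (chart y') by apply: subset_closure; exists y'.
rewrite hPP' => -[p Pp].
have v0 : set_val (repr p) != 0 := set_mem (valP (repr p)).
have pE : p = hompt v0 by rewrite -{1}[p]reprK; congr (\pi _); exact: val_inj.
rewrite pE in Pp; rewrite {1}pE projact_hompt => /eqmodP/andP[_ /=].
move=> /sub_rVP[a ae].
have e : row_mx 1%:M y' = a *: (set_val (repr p) *m G) := ae.
have -> : row_mx 1%:M y' *m invmx G = a *: set_val (repr p).
  by rewrite e -scalemxAl mulmxK.
rewrite linearZ /= -!scalemxAr !mxE mulrACA -expr2 mulr_ge0 ?sqr_ge0 //.
by have := projclosure_sign _ _ _ _ _ Pp w1P w2P; rewrite !mxE.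
Qed.

Lemma chart_map_image y : P y -> chart_denom G y != 0 -> P' (chart_map G y).
Proof.
move=> Py y0; apply: polyhedron_closed => //; rewrite -(projact_chart hG) // hPP'.
by exists (chart y) => //; apply: subset_closure; exists y.
Qed.

Lemma image_sign_closed w y : P y -> dual_cone P' w ->
  0 <= affine (w *m G^T) y * chart_denom G y.
Proof.
move=> Py wP'; rewrite chart_denomE !affine_mul_tr.
have : projclosure P' (projact hG (chart y)).
  by rewrite hPP'; exists (chart y) => //; apply: subset_closure; exists y.
by rewrite projact_hompt => /projclosure_sign; apply => //; exact: dual_cone_height.
Qed.

(* The image of P under G is convex in the chart, so it contains the images of
   all the points a y1 - b y2 with a, b > 0; letting a / b pass through 1 makes
   every form of the dual cone of P constant along the line through y1, y2. *)
Lemma chart_denom_sign y1 y2 : ~ contains_line P -> P y1 -> P y2 ->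
  0 < chart_denom G y1 -> chart_denom G y2 < 0 -> False.
Proof.
move=> noline P1 P2 d1 d2.
have n1 : chart_denom G y1 != 0 by rewrite gt_eqF.
have n2 : chart_denom G y2 != 0 by rewrite lt_eqF.
have comb w (al be : R) : dual_cone P w -> 0 < al -> 0 < be ->
    0 <= (al * affine w y1 - be * affine w y2) * (al - be).
  move=> wP al0 be0.
  pose D := al * chart_denom G y1 - be * chart_denom G y2.
  have D0 : 0 < D by rewrite subr_gt0 (@lt_trans _ _ 0) ?pmulr_rlt0 // mulr_gt0.
  pose t := - be * chart_denom G y2 / D.
  have t1 : 1 - t = al * chart_denom G y1 / D.
    by rewrite /t; apply: (mulIf (lt0r_neq0 D0)); rewrite mulrBl !divfK ?gt_eqF // /D; ring.
  have t0 : 0 <= t by rewrite divr_ge0 ?(ltW D0) // mulNr -mulrN mulr_ge0 ?oppr_ge0 // ltW.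
  have t1' : t <= 1 by rewrite -subr_ge0 t1 divr_ge0 ?(ltW D0) // mulr_ge0 // ltW.
  have P't := polyhedron_convex _ _ _ t hP' (chart_map_image _ P1 n1) (chart_map_image _ P2 n2) t0 t1'.
  have yE : row_mx 1%:M ((1 - t) *: chart_map G y1 + t *: chart_map G y2) *m invmx G =
      D^-1 *: (al *: row_mx 1%:M y1 - be *: row_mx 1%:M y2).
    have -> : row_mx 1%:M ((1 - t) *: chart_map G y1 + t *: chart_map G y2) =
        (1 - t) *: row_mx 1%:M (chart_map G y1) + t *: row_mx 1%:M (chart_map G y2) :> 'rV[R]_(1 + d).
      by rewrite !scale_row_mx add_row_mx -scalerDl subrK scale1r.
    rewrite !chart_mapE // t1 /t mulmxDl -!scalemxAl !mulmxK // !scalerA scalerBr !scalerA -scaleNr.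
    by congr (_ *: _ + _ *: _); [rewrite mulrAC mulfK // mulrC|rewrite mulrAC mulfK // mulrC mulrN].
  have := image_sign _ _ _ P't wP (dual_cone_height P).
  have E u : (u *m (D^-1 *: (al *: row_mx 1%:M y1 - be *: row_mx 1%:M y2))^T) 0 0 =
      D^-1 * (al * affine u y1 - be * affine u y2).
    rewrite [(D^-1 *: _)^T]linearZ /= [(_ - _)^T]linearB /= ![(_ *: _)^T]linearZ /=.
    by rewrite -scalemxAr mulmxBr -!scalemxAr /affine !mxE.
  rewrite yE !E !affine_height !mulr1.
  by rewrite mulrACA pmulr_rge0 // mulr_gt0 // invr_gt0.
have const w : dual_cone P w -> affine w y1 = affine w y2.
  move=> wP; have A1 := wP _ P1; have A2 := wP _ P2.
  apply/eqP; case: ltgtP => // h; exfalso.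
    (* With these multipliers [al > be] but [al * affine w y1 < be * affine w y2], contradicting
       [comb]. *)
    have := comb w (2 * affine w y2) (affine w y1 + affine w y2) wP.
    have -> : (2 * affine w y2 * affine w y1 - (affine w y1 + affine w y2) * affine w y2) *
      (2 * affine w y2 - (affine w y1 + affine w y2)) =
      - (affine w y2 * (affine w y2 - affine w y1) ^+ 2) by ring.
    have pos : 0 < affine w y2 * (affine w y2 - affine w y1) ^+ 2.
      by rewrite mulr_gt0 ?exprn_gt0 ?subr_gt0 // (le_lt_trans A1 h).
    by move=> H; have := H ltac:(lra) ltac:(lra); lra.
  have := comb w (affine w y1 + affine w y2) (2 * affine w y1) wP.
  have -> : ((affine w y1 + affine w y2) * affine w y1 - 2 * affine w y1 * affine w y2) *
      (affine w y1 + affine w y2 - 2 * affine w y1) =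
      - (affine w y1 * (affine w y1 - affine w y2) ^+ 2) by ring.
  have pos : 0 < affine w y1 * (affine w y1 - affine w y2) ^+ 2.
    by rewrite mulr_gt0 ?exprn_gt0 ?subr_gt0 // (le_lt_trans A2 h).
  by move=> H; have := H ltac:(lra) ltac:(lra); lra.
apply: noline; exists y1, (y1 - y2); split.
  by rewrite subr_eq0; apply: contraTneq d1 => ->; rewrite -leNgt ltW.
have [s PE] := polyhedron_dual _ hP.
move=> t; apply/PE => w ws; rewrite affineE dotvDr dotvZr.
have wP : dual_cone P w by move=> y /PE; apply.
have := const w wP; have := wP _ P1; rewrite !affineE dotvBr => h e.
have -> : dotv (rsubmx w) y1 - dotv (rsubmx w) y2 = 0 by lra.
by rewrite mulr0 addr0.
Qed.

Hypothesis hfull : full_dimensional P.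

Lemma full_dimensional_affine w : (forall y, P y -> affine w y = 0) -> w = 0.
Proof.
move: hfull => [p0 [p [Pp0 Pp pu]]] w0.
have r0 : rsubmx w = 0.
  apply/trmx_inj; rewrite trmx0; apply: (can_inj (mulKmx pu)); rewrite mulmx0.
  apply/colP => i.
  have := w0 _ (Pp i); have := w0 _ Pp0; rewrite !affineE => e1 e2.
  have : dotv (rsubmx w) (p i - p0) = 0 by rewrite dotvBr; lra.
  rewrite /dotv !mxE; apply: etrans; apply: eq_bigr => j _.
  by rewrite !mxE mulrC.
have := w0 _ Pp0; rewrite affineE r0 /dotv big1 => [|i _]; last by rewrite mxE mul0r.
rewrite addr0 => l0; rewrite -[w]hsubmxK r0.
have -> : lsubmx w = 0 by apply/rowP => i; rewrite !ord1 l0 mxE.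
by rewrite row_mx0.
Qed.

Lemma exists_chart_denom_neq0 : exists2 y, P y & chart_denom G y != 0.
Proof.
apply: contrapT => h.
have : height *m G^T = 0.
  apply: full_dimensional_affine => y Py; apply/eqP/negPn/negP => y0.
  by apply: h; exists y => //; rewrite chart_denomE.
move=> /(congr1 (mulmx^~ (invmx G^T))); rewrite mulmxK ?unitmx_tr // mul0mx.
by apply/eqP; exact: row_mx1_neq0.
Qed.

(** [eps] is the constant sign of the denominator on [P]; with it, [eps *: G] sends [(1, y)] to a
    nonnegative height for every [y] in [P]. *)
Lemma dual_cone_image : ~ contains_line P -> exists eps : R,
  [/\ eps = 1 \/ eps = -1, forall y, P y -> 0 <= eps * chart_denom G y &
    forall w, dual_cone P' w <-> dual_cone P (w *m (eps *: G^T))].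
Proof.
move=> noline; have [y0 P0 n0] := exists_chart_denom_neq0.
pose eps := Num.sg (chart_denom G y0).
have eps1 : eps = 1 \/ eps = -1.
  rewrite /eps; have [h|h|h] := ltrgtP 0 (chart_denom G y0); last by move: n0; rewrite -h eqxx.
    by left; rewrite gtr0_sg.
  by right; rewrite ltr0_sg.
have eps2 : eps * eps = 1 by case: eps1 => ->; rewrite ?mulr1 ?mulN1r ?opprK.
have pos y : P y -> 0 <= eps * chart_denom G y.
  move=> Py; rewrite leNgt; apply/negP.
  rewrite /eps; have [h|h|h] := ltrgtP 0 (chart_denom G y0); last by move: n0; rewrite -h eqxx.
    rewrite gtr0_sg // mul1r => h'; exact: (chart_denom_sign y0 y).
  rewrite ltr0_sg // mulN1r oppr_lt0 => h'; exact: (chart_denom_sign y y0).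
have affE w y : affine (w *m (eps *: G^T)) y = eps * affine (w *m G^T) y.
  by rewrite -scalemxAr /affine -scalemxAl mxE.
exists eps; split=> // w; split.
  move=> wP' y Py; rewrite affE.
  have nz x : P x -> chart_denom G x != 0 -> 0 <= eps * affine (w *m G^T) x.
    move=> Px x0; have := image_sign_closed w x Px wP'.
    have dx : 0 < eps * chart_denom G x.
      rewrite lt_def pos // andbT mulf_neq0 //.
      by apply: contra_eq_neq eps2 => ->; rewrite mul0r eq_sym oner_eq0.
    by rewrite -[_ * chart_denom G x]mul1r -eps2 mulrACA (pmulr_lge0 _ dx).
  have [d0|d0] := eqVneq (chart_denom G y) 0; last exact: nz.
  rewrite leNgt; apply/negP => Fy.
  pose F x := eps * affine (w *m G^T) x.
  have F0 : 0 <= F y0 by exact: nz.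
  have D0 : 0 < 2 * (F y0 - F y) by rewrite mulr_gt0 // subr_gt0 (lt_le_trans Fy).
  (* Moving from [y] towards [y0] makes the denominator nonzero; this [t] gives the form the value
     [F y / 2], still negative. *)
  pose t := - F y / (2 * (F y0 - F y)).
  have tE : t * (F y0 - F y) = - F y / 2.
    by rewrite /t invfM; field; rewrite subr_eq0 gt_eqF // (lt_le_trans Fy).
  have t0 : 0 < t by rewrite divr_gt0 // oppr_gt0.
  have t1 : t <= 1 by rewrite ler_pdivrMr // mul1r; lra.
  have := nz _ (polyhedron_convex _ _ _ t hP Py P0 (ltW t0) t1).
  rewrite chart_denomE !affine_comb -!chart_denomE d0 mulr0 add0r mulf_neq0 ?(gt_eqF t0) //.
  move=> /(_ isT); rewrite mulrDr !(mulrCA eps) -/(F y) -/(F y0).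
  by move: Fy; rewrite -/(F y); lra.
move=> wP y' Py'.
have hP2 : dual_cone P (height *m (eps *: G^T)).
  by move=> y /pos; rewrite affE -chart_denomE.
have := image_sign _ _ _ Py' wP hP2.
have E u : (u *m (eps *: G^T) *m (row_mx 1%:M y' *m invmx G)^T) 0 0 = eps * affine u y'.
  rewrite trmx_mul -mulmxA -scalemxAl -scalemxAr mxE /affine; congr (_ * _).
  by rewrite mulmxA trmx_inv mulmxA mulmxK // unitmx_tr.
by rewrite !E affine_height mulr1 mulrAC eps2 mul1r.
Qed.

End Image.
End ProjectiveImage.

(** * The Jacobian of a projective map *)

Section Jacobian.
Context {R : realType}.

Lemma is_diff_linear (V W : normedModType R) (f : V -> W) x :
  linear f -> continuous f -> is_diff x f f.
Proof.
move=> f_lin fc.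
pose fM := GRing.isLinear.Build _ _ _ _ _ f_lin.
pose fL : {linear _ -> _} := HB.pack f fM.
apply: DiffDef; first exact: (linear_differentiable (f := fL)).
exact: (diff_lin (f := fL)).
Qed.

Lemma is_diff_scale (U V : normedModType R) (k dk : U -> R) (f df : U -> V) x :
  is_diff x k dk -> is_diff x f df ->
  is_diff x (fun y => k y *: f y) (fun h => k x *: df h + dk h *: f x).
Proof.
move=> kd fd.
have sb : bilinear_for (GRing.Scale.Law.clone _ _ *:%R _)
    (GRing.Scale.Law.clone _ _ *:%R _) ( *:%R : R -> V -> V).
  by split=> [v|a] c y z /=; rewrite ?scalerDl ?scalerDr !scalerA // mulrC.
pose sM := bilinear_isBilinear.Build _ _ _ _ _ _ _ sb.
pose sL : {bilinear R -> V -> V} := HB.pack ( *:%R : R -> V -> V) sM.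
have sc : continuous (fun p : R * V => sL p.1 p.2) by exact: scale_continuous.
have sd p : is_diff p (fun q : R * V => q.1 *: q.2) (fun q => p.1 *: q.2 + q.1 *: p.2).
  apply: DiffDef; first exact: (differentiable_bilin (f := sL)).
  exact: (diff_bilin (f := sL)).
have -> : (fun y => k y *: f y) = (fun q : R * V => q.1 *: q.2) \o (fun y => (k y, f y)) by [].
by apply: is_diff_eq.
Qed.

Context {d : nat}.
Implicit Types (G : 'M[R]_(1 + d)) (z : 'rV[R]_d).

Lemma is_diff_affine m (b : 'rV[R]_m) (A : 'M[R]_(d, m)) z :
  is_diff z (fun x : 'rV[R]_d => b + x *m A : 'rV[R]_m) (fun x => x *m A).
Proof.
have L : is_diff z (fun x : 'rV[R]_d => x *m A : 'rV[R]_m) (fun x => x *m A).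
  apply: is_diff_linear; last exact: mulmx_continuous.
  by move=> a x y; rewrite mulmxDl scalemxAl.
have -> : (fun x : 'rV[R]_d => b + x *m A : 'rV[R]_m) = cst b + (fun x => x *m A) by [].
by apply: is_diff_eq; rewrite add0r.
Qed.

Lemma homimageE G z : homimage G z =
  row_mx (ulsubmx G + z *m dlsubmx G) (ursubmx G + z *m drsubmx G).
Proof. by rewrite /homimage -{1}[G]submxK mul_row_block !mul1mx. Qed.

Lemma jacobian_chart_map G z : chart_denom G z != 0 ->
  'J (chart_map G) z = (chart_denom G z)^-1 *:
    (drsubmx G - dlsubmx G *m ((chart_denom G z)^-1 *: rsubmx (homimage G z))).
Proof.
move=> z0; set den := chart_denom G z; set r := rsubmx (homimage G z).
have dden : is_diff z (chart_denom G) (fun x => (x *m dlsubmx G) 0 0).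
  have c : is_diff (ulsubmx G + z *m dlsubmx G) (fun M : 'rV[R]_1 => M 0 0 : R)
      (fun M => M 0 0).
    by apply: is_diff_linear; [move=> a x y; rewrite !mxE|exact: coord_continuous].
  have -> : chart_denom G = (fun M : 'rV[R]_1 => M 0 0 : R) \o
      (fun x => ulsubmx G + x *m dlsubmx G).
    by apply/funext => x; rewrite /chart_denom homimageE row_mxKl.
  exact: (is_diff_comp (is_diff_affine _ (ulsubmx G) (dlsubmx G) z) c).
have dinv : is_diff z (fun x => (chart_denom G x)^-1)
    (fun x => - den ^- 2 * (x *m dlsubmx G) 0 0).
  apply: DiffDef; first exact: differentiableV.
  by rewrite diffV // diff_val.
have dr : is_diff z (fun x => rsubmx (homimage G x)) (fun x => x *m drsubmx G).
  have -> : (fun x => rsubmx (homimage G x)) = (fun x => ursubmx G + x *m drsubmx G).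
    by apply/funext => x; rewrite homimageE row_mxKr.
  exact: is_diff_affine.
have := is_diff_scale _ _ _ _ _ _ _ dinv dr => -[_ dE].
apply/row_matrixP => i; rewrite !rowE mul_rV_lin1 dE -/den -/r -scalemxAr mulmxBr.
rewrite scalerBr; congr (_ + _).
rewrite mulmxA ['e_i *m dlsubmx G in RHS]mx11_scalar mul_scalar_mx !scalerA -scaleNr.
by congr (_ *: _); rewrite expr2 invfM; ring.
Qed.

(** A unimodular row operation puts the homogeneous image of [z] in the first row of [G]. The
    Jacobian is the inverse denominator times the Schur complement [S] of the corner entry. *)
Lemma det_jacobian_chart_map G z : chart_denom G z != 0 ->
  \det ('J (chart_map G) z) = \det G / chart_denom G z ^+ d.+1.
Proof.
move=> z0; rewrite jacobian_chart_map // detZ; set den := chart_denom G z.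
set S := drsubmx G - _.
have dM : \det G = \det (block_mx 1%:M z 0 1%:M *m G).
  by rewrite det_mulmx det_ublock !det1 !mul1r.
have denE : ulsubmx G + z *m dlsubmx G = den%:M.
  by apply/rowP => i; rewrite !ord1 /den /chart_denom homimageE row_mxKl [in RHS]mxE eqxx mulr1n.
have -> : \det G = den * \det S.
  rewrite dM -{1}[G]submxK mulmx_block !mul1mx !mul0mx !add0r denE.
  have -> : block_mx den%:M (ursubmx G + z *m drsubmx G) (dlsubmx G) (drsubmx G) =
      block_mx den%:M 0 (dlsubmx G) 1%:M *m
      block_mx 1%:M (den^-1 *: rsubmx (homimage G z)) 0 S.
    rewrite mulmx_block !mulmx0 !mul0mx !mulmx1 !addr0 !mul1mx /S addrCA subrr addr0.
    by rewrite mul_scalar_mx scalerA mulfV // scale1r homimageE row_mxKr.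
  by rewrite det_mulmx det_lblock det_ublock !det1 det_scalar1 mul1r mulr1.
by rewrite exprVn exprS invfM mulrACA divff // mul1r mulrC.
Qed.
End Jacobian.

(** * Projective invariance of the dual volume *)

Section ProjectiveInvariance.
Context {R : realType} {d : nat}.
Implicit Types (P : set 'rV[R]_d) (G : 'M[R]_(1 + d)) (y z : 'rV[R]_d).

Lemma in_cone_mulmx n (W K : 'M[R]_n) p : W \in unitmx -> K \in unitmx ->
  in_cone (W *m K) p = in_cone W (p *m invmx K).
Proof.
move=> Wu Ku; have WKu : W *m K \in unitmx by rewrite unitmx_mul Wu.
apply/in_coneP/in_coneP => // -[c c0 pE]; exists c => //.
  by rewrite pE mulmxA mulmxK.
by rewrite mulmxA -pE mulmxKV.
Qed.

Lemma det_jacobian_sign G z (eps : R) : eps = 1 \/ eps = -1 -> chart_denom G z != 0 ->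
  eps ^+ d.+1 * Num.sg (\det G) * \det ('J (chart_map G) z) =
  `|\det G| / (eps * chart_denom G z) ^+ d.+1.
Proof.
move=> eps1 z0; rewrite det_jacobian_chart_map // normrEsg exprMn.
have -> : (eps ^+ d.+1 * chart_denom G z ^+ d.+1)^-1 = eps ^+ d.+1 / chart_denom G z ^+ d.+1.
  rewrite invfM; congr (_ * _); rewrite -exprVn; congr (_ ^+ _).
  by case: eps1 => ->; rewrite ?invr1 ?invrN1.
by ring.
Qed.

(** If the denominator vanished at [z], it would have the wrong sign just beyond [z] on the line
    from [y0], still inside [P]. *)
Lemma chart_denom_interior P G z (eps : R) : G \in unitmx -> full_dimensional P ->
  (forall y, P y -> 0 <= eps * chart_denom G y) -> eps != 0 -> P° z ->
  0 < eps * chart_denom G z.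
Proof.
move=> Gu Pfull pos eps0 Pz.
have [y0 Py0 n0] := exists_chart_denom_neq0 P G Gu Pfull.
have d0 : 0 < eps * chart_denom G y0 by rewrite lt_def mulf_neq0 //= pos.
rewrite lt_def pos ?andbT; last exact: interior_subset Pz.
apply/eqP => dz0.
pose g (t : R) := z + t *: (z - y0).
have gc : {for 0, continuous g}.
  apply: cvgD; first exact: cvg_cst.
  by apply: (cvgZr_tmp (F := nbhs (0 : R))); exact: cvg_id.
have : nbhs (0 : R) (g @^-1` P).
  by apply: gc; rewrite /g scale0r addr0.
move=> /nbhs_ballP[r /= r0 rP].
have /pos : P (g (r / 2)).
  apply: rP; rewrite /ball /= sub0r normrN gtr0_norm ?divr_gt0 //.
  by rewrite ltr_pdivrMr // ltr_pMr // ltr1n.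
have -> : g (r / 2) = (1 - (- (r / 2))) *: z + (- (r / 2)) *: y0.
  by rewrite /g opprK scalerDl scale1r scalerBr scaleNr addrA.
rewrite chart_denomE affine_comb -!chart_denomE mulrDr !(mulrCA eps) dz0 mulr0 add0r.
by rewrite mulNr oppr_ge0 leNgt mulr_gt0 // divr_gt0.
Qed.

(** Two tilings of the dual cone of [P] are compared: the lifts of [T], with weight 1, and the lifts
    of [T'] carried over by [K], with weight -1. *)
Lemma dual_volume_projective P P' G z (eps : R) n n'
    (T : 'I_n -> 'M[R]_d) (T' : 'I_n' -> 'M[R]_d) :
  polyhedron P -> polyhedron P' -> G \in unitmx -> eps = 1 \/ eps = -1 ->
  (forall w, dual_cone P' w <-> dual_cone P (w *m (eps *: G^T))) ->
  fan_triangulation (normal_fan P) T -> fan_triangulation (normal_fan P') T' ->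
  chart_denom G z != 0 -> dual_volume_defined P T z ->
  dual_volume_defined P' T' (chart_map G z) ->
  dual_volume P T z = `|\det G| / (eps * chart_denom G z) ^+ d.+1 *
    dual_volume P' T' (chart_map G z).
Proof.
move=> hP hP' Gu eps1 dualE hT hT' z0 Tz T'z.
pose K := eps *: G^T.
have eps0 : eps != 0 by case: eps1 => ->; rewrite ?oppr_eq0 oner_eq0.
have epsu : eps \is a GRing.unit by rewrite unitfE.
have Ku : K \in unitmx by rewrite unitmxZ // unitmx_tr.
have detK : `|\det K| = `|\det G|.
  rewrite detZ det_tr normrM normrX.
  by case: eps1 => ->; rewrite ?normrN1 ?normr1 expr1n mul1r.
have Tu i : T i \in unitmx by case: hT.
have T'u i : T' i \in unitmx by case: hT'.
pose a := eps * chart_denom G z.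
have a0 : a != 0 by rewrite mulf_neq0.
(* Every generator of a transported cone thus gains the factor [a], and each cone has [d.+1]
   generators. *)
have Kx : K *m (row_mx 1%:M z)^T = a *: (row_mx 1%:M (chart_map G z))^T.
  rewrite -scalemxAl -trmx_mul chart_mapE // [(_^-1 *: _)^T]linearZ /= scalerA.
  by rewrite /a mulfK.
pose W (s : 'I_n + 'I_n') := match s with
  inl i => lift_mx P (T i) | inr i => lift_mx P' (T' i) *m K end.
pose c (s : 'I_n + 'I_n') : R := match s with inl _ => 1 | inr _ => -1 end.
(* Facet normals of the cones of the fan, extended by 0 so that they only see the linear part of a
   form. *)
pose N m (S : 'I_m -> 'M[R]_d) : seq 'cV[R]_(1 + d) :=
  [seq col_mx 0 (col ij.2 (invmx (S ij.1))) | ij <- enum {: 'I_m * 'I_d}].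
have N0 m (S : 'I_m -> 'M[R]_d) b : (forall i, S i \in unitmx) -> b \in N m S -> b != 0.
  move=> Su /mapP[[i j] _ /= ->]; apply/eqP => /(congr1 dsubmx).
  rewrite col_mxKd linear0 => /(congr1 (mulmx (S i))).
  rewrite -col_mul mulmxV // mulmx0 => /matrixP/(_ j 0) /eqP.
  by rewrite !mxE eqxx oner_eq0.
have NE m (S : 'I_m -> 'M[R]_d) p i j :
    {in N m S, forall b : 'cV_(1 + d), (p *m b) 0 0 != 0} ->
    (rsubmx p *m col j (invmx (S i))) 0 0 != 0.
  move=> /(_ (col_mx 0 (col j (invmx (S i))))).
  rewrite -{1}[p]hsubmxK mul_row_col mulmx0 add0r; apply.
  exact: (map_f (fun ij => col_mx 0 (col ij.2 (invmx (S ij.1)))) (mem_enum _ (i, j))).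
have prodE i : \prod_j (lift_mx P' (T' i) *m K *m (row_mx 1%:M z)^T) j 0 =
    a ^+ d.+1 * \prod_j (lift_mx P' (T' i) *m (row_mx 1%:M (chart_map G z))^T) j 0.
  rewrite -mulmxA Kx -scalemxAr.
  under eq_bigr => j _ do rewrite mxE.
  by rewrite big_split /= prodr_const card_ord.
have := cone_valuation (1 + d)%N _ xpredT c W
  (N n T ++ [seq invmx K *m b | b <- N n' T']) (row_mx 1%:M z)^T.
have splitS (F : 'I_n + 'I_n' -> R) :
    \sum_s F s = \sum_i F (inl i) + \sum_i F (inr i) by exact: big_sumType.
rewrite !splitS /= => H.
have {H} : \sum_i 1 * (`|\det (lift_mx P (T i))| /
      \prod_j (lift_mx P (T i) *m (row_mx 1%:M z)^T) j 0) +
    \sum_i -1 * (`|\det (lift_mx P' (T' i) *m K)| /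
      \prod_j (lift_mx P' (T' i) *m K *m (row_mx 1%:M z)^T) j 0) = 0.
  apply: H.
  - move=> [i|i] _; first exact: lift_mx_unit.
    by rewrite unitmx_mul Ku lift_mx_unit.
  - move=> b; rewrite mem_cat => /orP[/N0|/mapP[b' /N0 b'0 ->]]; first exact.
    apply/eqP => /(congr1 (mulmx K)); rewrite mulKVmx // mulmx0.
    by apply/eqP/b'0.
  - move=> [i|i] _ j /=.
      have : \prod_j (lift_mx P (T i) *m (row_mx 1%:M z)^T) j 0 != 0.
        by rewrite lift_mx_factors; apply/prodf_neq0 => k _; exact: Tz.
      by move=> /prodf_neq0 /(_ j isT).
    have : \prod_j (lift_mx P' (T' i) *m K *m (row_mx 1%:M z)^T) j 0 != 0.
      rewrite prodE mulf_neq0 ?expf_neq0 // lift_mx_factors.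
      by apply/prodf_neq0 => k _; exact: T'z.
    by move=> /prodf_neq0 /(_ j isT).
  move=> p gen; rewrite splitS /=.
  have genT : {in N n T, forall b : 'cV_(1 + d), (p *m b) 0 0 != 0}.
    by move=> b bN; apply: gen; rewrite mem_cat bN.
  have genT' : {in N n' T', forall b : 'cV_(1 + d), (p *m invmx K *m b) 0 0 != 0}.
    by move=> b bN; rewrite -mulmxA; apply: gen; rewrite mem_cat map_f ?orbT.
  under eq_bigr do rewrite mul1r.
  under [X in _ + X]eq_bigr => i _ do rewrite mulN1r in_cone_mulmx ?lift_mx_unit //.
  rewrite sumrN !triangulation_dual_cone // => [|i j|i j]; try exact: NE.
  have -> : `[< dual_cone P' (p *m invmx K) >] = `[< dual_cone P p >].
    by apply: asbool_equiv_eq; rewrite dualE -/K mulmxKV.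
  by rewrite subrr.
under eq_bigr do rewrite mul1r.
rewrite -dual_volumeE => /eqP.
under eq_bigr => i _ do rewrite mulN1r prodE det_mulmx normrM detK.
rewrite sumrN subr_eq0 => /eqP ->.
rewrite dual_volumeE mulr_sumr; apply: eq_bigr => i _.
by rewrite -/a invfM; ring.
Qed.
End ProjectiveInvariance.

(** The sign [e] accounts for ignoring orientations: it is fixed by positivity on the interior of
    [P]. The identity of rational functions is stated pointwise, away from the poles of the
    summands. *)
Theorem corollary5p8 (R : realType) (d : nat) (P P' : set 'rV[R]_d)
    (G : 'M[R]_(1 + d)) (hG : G \in unitmx)
    (hP : polyhedron P) (hPfull : full_dimensional P)
    (hPline : ~ contains_line P)
    (hP' : polyhedron P')
    (hPP' : projclosure P' = projact hG @` projclosure P) :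
  exists e : R,
    [/\ e = 1 \/ e = -1,
        (forall z, P° z -> 0 < e * \det ('J (chart_map G) z))
      & forall (n n' : nat) (T : 'I_n -> 'M[R]_d) (T' : 'I_n' -> 'M[R]_d),
          fan_triangulation (normal_fan P) T ->
          fan_triangulation (normal_fan P') T' ->
          forall z : 'rV[R]_d,
            chart_denom G z != 0 ->
            dual_volume_defined P T z ->
            dual_volume_defined P' T' (chart_map G z) ->
            dual_volume P T z =
              e * \det ('J (chart_map G) z)
                * dual_volume P' T' (chart_map G z)].
Proof.
have [eps [eps1 pos dualE]] := dual_cone_image _ _ _ hG hP hP' hPP' hPfull hPline.
have eps0 : eps != 0 by case: eps1 => ->; rewrite ?oppr_eq0 oner_eq0.
have detG : \det G != 0 by rewrite -unitfE -unitmxE.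
(* The Jacobian determinant is [\det G] over the [d.+1]-st power of the denominator, whose sign on
   the interior of [P] is [eps]. *)
exists (eps ^+ d.+1 * Num.sg (\det G)); split.
- have : `|eps ^+ d.+1 * Num.sg (\det G)| = 1.
    rewrite normrM normrX normr_sg detG mulr1.
    by case: eps1 => ->; rewrite ?normrN1 ?normr1 expr1n.
  by move=> /eqP; rewrite eqr_norml ler01 andbT => /orP[]/eqP; [left|right].
- move=> z /(chart_denom_interior _ _ _ _ hG hPfull pos eps0) dz.
  have z0 : chart_denom G z != 0.
    by apply: contraTneq dz => ->; rewrite mulr0 ltxx.
  by rewrite (det_jacobian_sign _ _ _ eps1 z0) divr_gt0 ?exprn_gt0 // normr_gt0.
move=> n n' T T' hT hT' z z0 Tz T'z.
rewrite (det_jacobian_sign _ _ _ eps1 z0).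
exact: (dual_volume_projective _ _ _ _ _ _ _ _ _ hP hP' hG eps1 dualE).
Qed.
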